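(* There exists a function $h$ with $h(\varepsilon)\to 0$ as $\varepsilon\to 0$ and the following property. For every unital $C^*$-algebra $A$, every unital $C^*$-algebra $B$, and every $\varepsilon$-$*$-homomorphism $\varphi\colon A\to B$, if there exists a group homomorphism $\pi\colon U(A)\to U(B)$ (not required to be continuous) such that $$\sup_{u\in U(A)}\|\varphi(u)-\pi(u)\|\le\varepsilon+120\varepsilon^2,$$ then there exists a $*$-homomorphism $\Phi\colon A\to B$ such that $\Phi(\exp(ia))=\pi(\exp(ia))$ for all self-adjoint $a\in A$ and $\sup_{\|a\|\le 1}\|\varphi(a)-\Phi(a)\|\le h(\varepsilon)$.
   Context: $U(A)$ denotes the unitary group of a unital $C^*$-algebra $A$. For unital $C^*$-algebras $A,B$ and $\varepsilon\ge 0$, an $\varepsilon$-$*$-homomorphism is a map $\varphi\colon A\to B$ (no linearity or continuity assumed) such that for all $a,b\in A$ with $\|a\|,\|b\|\le 1$ and all $\lambda\in\mathbb C$ with $|\lambda|\le 1$ we have $\|\varphi(a)\|\le 1$ and $\|\varphi(a+b)-\varphi(a)-\varphi(b)\|\le\varepsilon$, $\|\varphi(ab)-\varphi(a)\varphi(b)\|\le\varepsilon$, $\|\varphi(a^* )-\varphi(a)^*\|\le\varepsilon$, $\|\varphi(\lambda a)-\lambda\varphi(a)\|\le\varepsilon$.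
   Formalization: The property is claimed only for 0 ≤ ε < ε₀, with a universal ε₀ > 0 chosen together with h; for large ε it is false (A = B = ℂ, φ(z) = π(z) = z², ε = 2). *)

(* Defs.v *)
From HB Require Import structures.
From mathcomp Require Import all_boot all_order all_algebra.
From mathcomp Require Import all_classical all_reals all_analysis.
From mathcomp Require Import complex ring lra.

Set Implicit Arguments.
Unset Strict Implicit.
Unset Printing Implicit Defensive.

Import Order.TTheory GRing.Theory Num.Theory.
Import numFieldNormedType.Exports.

Local Open Scope classical_set_scope.
Local Open Scope ring_scope.
Local Open Scope complex_scope.

(* The multiplication is part of this mixin, and [GRing.PzRing] is derived from
   it below, because Hierarchy Builder rejects a structure that inherits from
   both [GRing.PzSemiRing] and [Num.SemiNormedZmodule] below [Num.NumDomain].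
   As [PzRing] does not require [1 != 0], the zero algebra is included. *)
HB.mixin Record isCStarAlgebra (R : realType) A
    of CompleteNormedModule R[i] A := {
  cone : A;
  cmul : A -> A -> A;
  cmulA : associative cmul;
  cmul1x : left_id cone cmul;
  cmulx1 : right_id cone cmul;
  cmulDl : left_distributive cmul +%R;
  cmulDr : right_distributive cmul +%R;
  cscaleAl : forall (k : R[i]) (x y : A), k *: cmul x y = cmul (k *: x) y;
  cscaleAr : forall (k : R[i]) (x y : A), k *: cmul x y = cmul x (k *: y);
  norm_cmul_le : forall x y : A, `|cmul x y| <= `|x| * `|y|;
  star : A -> A;
  starK : involutive star;
  starD : {morph star : x y / x + y};
  starZ : forall (k : R[i]) (x : A), star (k *: x) = k^*%C *: star x;
  star_cmul : forall x y : A, star (cmul x y) = cmul (star y) (star x);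
  norm_star_cmul : forall x : A, `|cmul (star x) x| = `|x| ^+ 2
}.

#[short(type="cstarAlgType")]
HB.structure Definition CStarAlgebra (R : realType) :=
  {A of CompleteNormedModule R[i] A & isCStarAlgebra R A}.

HB.instance Definition _ (R : realType) (A : cstarAlgType R) :=
  GRing.Zmodule_isPzRing.Build A
    (@cmulA R A) (@cmul1x R A) (@cmulx1 R A) (@cmulDl R A) (@cmulDr R A).

Definition cexp (R : realType) (A : cstarAlgType R) (x : A) : A :=
  limn (series (fun n : nat => (n`!%:R : R[i])^-1 *: x ^+ n)).

Definition is_unitary (R : realType) (A : cstarAlgType R) : pred A :=
  [pred u | (star u * u == 1) && (u * star u == 1)].

Section triangle.
Variable V : zmodType.
Implicit Type F : nat -> nat -> V.

Lemma sum_triangle F N :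
  \sum_(i < N) \sum_(j < N | (i + j < N)%N) F i j =
  \sum_(n < N) \sum_(i < n.+1) F i (n - i)%N.
Proof.
rewrite [RHS](eq_bigr (fun n : 'I_N =>
    \sum_(i < N | (i < n.+1)%N) F i (n - i)%N)); last first.
  by move=> n _; rewrite (big_ord_widen N (fun i => F i (n - i)%N)).
rewrite [RHS](exchange_big_dep xpredT)//=; apply: eq_bigr => i _.
rewrite -(big_mkord (fun n => (i < n.+1)%N) (fun n => F i (n - i)%N)).
rewrite -(big_mkord (fun j => (i + j < N)%N) (fun j => F i j)).
transitivity (\sum_(i <= n < N) F i (n - i)%N); last first.
  by rewrite (big_nat_widenl i 0).
rewrite (_ : \sum_(i <= n < N) F i (n - i)%N =
    \sum_(0 + i <= n < N) F i (n - i)%N)%R; last by rewrite add0n.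
rewrite big_addn.
rewrite (big_nat_widen 0 (N - i) N) ?leq_subr//=.
by apply: eq_big => j; rewrite ?ltn_subRL ?addnK.
Qed.

Lemma sum_square_triangle F N :
  \sum_(i < N) \sum_(j < N) F i j =
  \sum_(n < N) \sum_(i < n.+1) F i (n - i)%N +
  \sum_(i < N) \sum_(j < N | ~~ (i + j < N)%N) F i j.
Proof.
rewrite -sum_triangle -big_split; apply: eq_bigr => i _.
by rewrite (bigID (fun j : 'I_N => (i + j < N)%N)).
Qed.

End triangle.

Lemma sum_exp_coeff (R : realType) (r : R) (n : nat) :
  \sum_(i < n.+1) exp_coeff r i * exp_coeff r (n - i)%N = exp_coeff (r + r) n.
Proof.
rewrite /exp_coeff/= exprDn mulr_suml; apply: eq_bigr => i _.
have le_in : (i <= n)%N by rewrite -ltnS.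
rewrite -(bin_fact le_in) -mulr_natr !natrM.
have := fact_gt0 i; have := fact_gt0 (n - i)%N.
have : (0 < 'C(n, i))%N by rewrite bin_gt0.
rewrite -!(ltr0n R) => c0 a0 b0; rewrite (mulrC (r ^+ (n - i))).
by field; rewrite !gt_eqF.
Qed.

Section cstar_theory.
Variables (R : realType) (A : cstarAlgType R).
Implicit Types (x y a : A) (k : R[i]) (N : nat).

Lemma starM x y : star (x * y) = star y * star x.
Proof. exact: star_cmul. Qed.

Lemma norm_starM x : `|star x * x| = `|x| ^+ 2.
Proof. exact: norm_star_cmul. Qed.

Lemma normM_le x y : `|x * y| <= `|x| * `|y|.
Proof. exact: norm_cmul_le. Qed.

Lemma cscalerAl k x y : k *: (x * y) = (k *: x) * y.
Proof. exact: cscaleAl. Qed.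

Lemma cscalerAr k x y : k *: (x * y) = x * (k *: y).
Proof. exact: cscaleAr. Qed.

Lemma star1 : star 1 = 1 :> A.
Proof. by have := starM (star 1) 1; rewrite mulr1 starK mulr1. Qed.

Lemma star0 : star 0 = 0 :> A.
Proof. by apply: (addrI (star 0)); rewrite -starD !addr0. Qed.

Lemma starN x : star (- x) = - star x.
Proof. by apply: (addrI (star x)); rewrite -starD !subrr star0. Qed.

Lemma starX x n : star (x ^+ n) = star x ^+ n.
Proof. by elim: n => [|n IH]; rewrite ?expr0 ?star1// exprS exprSr starM IH. Qed.

Lemma star_sum n (F : nat -> A) :
  star (\sum_(i < n) F i) = \sum_(i < n) star (F i).
Proof. exact: (big_morph _ (@starD _ _) star0). Qed.

Lemma norm_star x : `|star x| = `|x|.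
Proof.
suff le y : `|y| <= `|star y|.
  by apply/eqP; rewrite eq_le le -{2}(starK x) le.
have [->|y0] := eqVneq `|y| 0; first exact: normr_ge0.
have ygt0 : 0 < `|y| by rewrite lt_neqAle eq_sym y0 normr_ge0.
by rewrite -(ler_pM2r ygt0) -expr2 -norm_starM normM_le.
Qed.

Definition rnorm x : R := complex.Re `|x|.

Lemma rnormE x : `|x| = (rnorm x)%:C.
Proof.
have := normr_ge0 x; rewrite /rnorm lecE; case: `|x| => u v /= /andP[/eqP -> _].
by [].
Qed.

Lemma rnorm_ge0 x : 0 <= rnorm x.
Proof. by have := normr_ge0 x; rewrite rnormE lecR. Qed.

Lemma le_rnorm x (c : R) : (rnorm x <= c) = (`|x| <= c%:C).
Proof. by rewrite rnormE lecR. Qed.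

Lemma rnorm_sum (I : Type) (s : seq I) (P : pred I) (F : I -> A) :
  rnorm (\sum_(i <- s | P i) F i) <= \sum_(i <- s | P i) rnorm (F i).
Proof.
rewrite le_rnorm (le_trans (ler_norm_sum _ _ _))// rmorph_sum/=.
by apply: ler_sum => i _; rewrite rnormE.
Qed.

Lemma rnormM_le x y : rnorm (x * y) <= rnorm x * rnorm y.
Proof. by rewrite le_rnorm rmorphM/= -!rnormE normM_le. Qed.

Lemma rnorm1_le : rnorm 1 <= 1.
Proof.
have := norm_starM 1; rewrite star1 mulr1 rnormE -rmorphXn => /complexI.
have := rnorm_ge0 1; nra.
Qed.

Lemma rnormX_le x n : rnorm (x ^+ n) <= rnorm x ^+ n.
Proof.
elim: n => [|n IH]; first by rewrite !expr0 rnorm1_le.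
by rewrite !exprS (le_trans (rnormM_le _ _))// ler_wpM2l ?rnorm_ge0.
Qed.

Lemma rnormD_le x y : rnorm (x + y) <= rnorm x + rnorm y.
Proof. by rewrite le_rnorm rmorphD/= -!rnormE ler_normD. Qed.

Lemma rnormN x : rnorm (- x) = rnorm x.
Proof. by rewrite /rnorm normrN. Qed.

Lemma rnorm_cvg (u : nat -> A) x :
  u @ \oo --> x -> rnorm (x - u n) @[n --> \oo] --> 0.
Proof.
move=> /cvgrPdist_lt cv; apply/cvgrPdist_lt => e e0; near=> n.
rewrite sub0r normrN ger0_norm ?rnorm_ge0// -ltcR -rnormE.
by near: n; apply: cv; rewrite ltcR.
Unshelve. all: by end_near. Qed.

Lemma cvg_rnorm (u : nat -> A) x :
  rnorm (x - u n) @[n --> \oo] --> 0 -> u @ \oo --> x.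
Proof.
move=> /cvgrPdist_lt cv; apply/cvgrPdist_lt => -[e e'] /=.
rewrite ltcE/= => /andP[/eqP -> e0]; near=> n.
rewrite rnormE ltcR; have : `|0 - rnorm (x - u n)| < e by near: n; exact: cv.
by rewrite sub0r normrN ger0_norm ?rnorm_ge0.
Unshelve. all: by end_near. Qed.

Definition ecoef x (n : nat) : A := (n`!%:R : R[i])^-1 *: x ^+ n.

Lemma rnormZ k x : rnorm (k *: x) = complex.Re `|k| * rnorm x.
Proof. by apply: complexI; rewrite rmorphM/= -!rnormE normrZ. Qed.

Lemma rnorm_ecoef x n : rnorm (ecoef x n) <= exp_coeff (rnorm x) n.
Proof.
rewrite /ecoef rnormZ mulrC.
rewrite normfV normr_nat -(rmorph_nat (real_complex R)) -fmorphV.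
by rewrite ler_wpM2r ?invr_ge0 ?ler0n// rnormX_le.
Qed.

Lemma is_cvg_series_ecoef x : cvgn (series (ecoef x)).
Proof.
apply/cauchy_cvgP/cauchy_seriesP => -[e e'].
rewrite ltcE/= => /andP[/eqP -> e0].
have /cauchy_cvgP/cauchy_seriesP/(_ e e0) := is_cvg_series_exp_coeff (rnorm x).
apply: filterS => -[m n]/= lte.
rewrite rnormE ltcR (le_lt_trans (rnorm_sum _ _ _))// (le_lt_trans _ lte)//.
rewrite (le_trans _ (ler_norm _))//; apply: ler_sum => k _.
exact: rnorm_ecoef.
Qed.

Lemma cexp_cvg x : series (ecoef x) @ \oo --> cexp x.
Proof. exact: is_cvg_series_ecoef. Qed.

Lemma star_cvg (u : nat -> A) x :
  u @ \oo --> x -> (star \o u) @ \oo --> star x.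
Proof.
move=> /cvgrPdist_lt cv; apply/cvgrPdist_lt => e /cv; apply: filterS => n /=.
by rewrite -starN -starD norm_star.
Qed.

Lemma star_cexp x : star (cexp x) = cexp (star x).
Proof.
apply: (@cvg_unique _ (@norm_hausdorff _ A) (series (ecoef (star x)) @ \oo)).
- rewrite (_ : series _ = star \o series (ecoef x)).
    exact/star_cvg/cexp_cvg.
  apply/funext => n; rewrite /series/= !big_mkord star_sum.
  apply: eq_bigr => i _; rewrite /ecoef starZ starX.
  by rewrite fmorphV rmorph_nat.
- exact: cexp_cvg.
Qed.

Lemma cvg_mul (u v : nat -> A) x y :
  u @ \oo --> x -> v @ \oo --> y -> (u n * v n) @[n --> \oo] --> x * y.
Proof.
move=> /rnorm_cvg ux /rnorm_cvg vy; apply: cvg_rnorm.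
pose b n := rnorm (x - u n) * rnorm y + rnorm x * rnorm (y - v n) +
            rnorm (x - u n) * rnorm (y - v n).
apply: (@squeeze_cvgr _ _ _ _ (cst 0) b); last 2 first.
- exact: cvg_cst.
- rewrite (_ : 0 = 0 * rnorm y + rnorm x * 0 + 0 * 0); last by ring.
  apply: cvgD; last exact: cvgM.
  by apply: cvgD; apply: cvgM => //; exact: cvg_cst.
near=> n; rewrite rnorm_ge0/=.
have -> : x * y - u n * v n =
    (x - u n) * y + x * (y - v n) - (x - u n) * (y - v n).
  by rewrite -addrA [(x - u n) * (y - v n)]mulrBl subKr mulrBl mulrBr addrA subrK.
rewrite (le_trans (rnormD_le _ _))// rnormN lerD ?rnormM_le//.
by rewrite (le_trans (rnormD_le _ _))// lerD ?rnormM_le.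
Unshelve. all: by end_near. Qed.

Lemma ecoef0 x : ecoef x 0 = 1.
Proof. by rewrite /ecoef expr0 fact0 invr1 scale1r. Qed.

Lemma ecoef_addN x n : (0 < n)%N ->
  \sum_(i < n.+1) ecoef x i * ecoef (- x) (n - i)%N = 0.
Proof.
move=> n0; transitivity ((n`!%:R : R[i])^-1 *: (- x + x) ^+ n); last first.
  by rewrite addNr expr0n gtn_eqF// scaler0.
have cx : GRing.comm (- x) x by rewrite /GRing.comm mulNr mulrN.
rewrite exprDn_comm// scaler_sumr; apply: eq_bigr => i _.
rewrite /ecoef -cscalerAl -cscalerAr scalerA.
rewrite -(@scaler_nat R[i] A 'C(n, i)) scalerA.
rewrite (_ : x ^+ i * _ = (- x) ^+ (n - i) * x ^+ i); last first.
  exact/commrX/commr_sym/commrX.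
congr (_ *: _).
have le_in : (i <= n)%N by rewrite -ltnS.
rewrite -(bin_fact le_in) !natrM.
have := fact_gt0 i; have := fact_gt0 (n - i)%N.
have : (0 < 'C(n, i))%N by rewrite bin_gt0.
rewrite -!(ltr0n R[i]) => c0 a0 b0.
by field; rewrite !gt_eqF.
Qed.

Lemma series_ecoef_mulN x N :
  rnorm (1 - series (ecoef x) N.+1 * series (ecoef (- x)) N.+1) <=
  series (exp_coeff (rnorm x)) N.+1 * series (exp_coeff (rnorm x)) N.+1 -
  series (exp_coeff (rnorm x + rnorm x)) N.+1.
Proof.
rewrite /series/= !big_mkord !big_distrlr/=.
rewrite (sum_square_triangle (fun i j => ecoef x i * ecoef (- x) j)).
rewrite (sum_square_triangle
  (fun i j => exp_coeff (rnorm x) i * exp_coeff (rnorm x) j)).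
rewrite [in leRHS](eq_bigr (fun n : 'I_N.+1 =>
  exp_coeff (rnorm x + rnorm x) n)); last by move=> n _; exact: sum_exp_coeff.
rewrite [leRHS]addrAC subrr add0r big_ord_recl big_ord_recl big_ord0 !ecoef0.
rewrite mulr1 addr0 [X in _ + X + _]big1 ?addr0; last first.
  by move=> n _; apply: ecoef_addN.
rewrite opprD addrA subrr sub0r rnormN.
apply: (le_trans (rnorm_sum _ _ _)); apply: ler_sum => i _.
apply: (le_trans (rnorm_sum _ _ _)); apply: ler_sum => j _.
rewrite (le_trans (rnormM_le _ _))// ler_pM ?rnorm_ge0 ?rnorm_ecoef//.
by rewrite -[rnorm x]rnormN rnorm_ecoef.
Qed.

Lemma cexp_mulN x : cexp x * cexp (- x) = 1.
Proof.
pose S y n := series (ecoef y) n.+1.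
have cvS y : S y @ \oo --> cexp y.
  by have := @cexp_cvg y; rewrite -(cvg_shiftS (series (ecoef y))).
have := cvg_mul (cvS x) (cvS (- x)).
move=> cv; apply: (cvg_unique _ cv); first exact: norm_hausdorff.
apply: cvg_rnorm; set r := rnorm x.
have cve (t : R) : series (exp_coeff t) n.+1 @[n --> \oo] --> expR t.
  have := is_cvg_series_exp_coeff t.
  by rewrite -(cvg_shiftS (series (exp_coeff t))).
apply: (@squeeze_cvgr _ _ _ _ (cst 0) (fun n =>
  series (exp_coeff r) n.+1 * series (exp_coeff r) n.+1 -
  series (exp_coeff (r + r)) n.+1)); last 2 first.
- exact: cvg_cst.
- rewrite (_ : 0 = expR r * expR r - expR (r + r)); last by rewrite expRD subrr.
  by apply: cvgB => //; exact: cvgM.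
by near=> n; rewrite rnorm_ge0 series_ecoef_mulN.
Unshelve. all: by end_near. Qed.

Lemma cexp_unitary a : star a = a -> is_unitary (cexp ('i%C *: a)).
Proof.
move=> sa; have star_ia : star ('i%C *: a) = - ('i%C *: a).
  rewrite starZ sa -scaleNr; congr (_ *: _).
  by apply/eqP; rewrite eq_complex/= oppr0 !eqxx.
rewrite /is_unitary/= star_cexp star_ia cexp_mulN.
by rewrite -{2}['i%C *: a]opprK cexp_mulN eqxx.
Qed.

Lemma is_unitary1 : is_unitary (1 : A).
Proof. by rewrite /is_unitary/= star1 mulr1 eqxx. Qed.

Lemma is_unitaryM x y : is_unitary x -> is_unitary y -> is_unitary (x * y).
Proof.
move=> /andP[/eqP x1 /eqP x2] /andP[/eqP y1 /eqP y2]; rewrite /is_unitary/= starM.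
rewrite mulrA -(mulrA _ _ x) x1 mulr1 y1 eqxx/=.
by rewrite mulrA -(mulrA x) y2 mulr1 x2.
Qed.

Lemma is_unitary_star x : is_unitary x -> is_unitary (star x).
Proof. by rewrite /is_unitary/= starK andbC. Qed.

End cstar_theory.

Section unitary.
Variables (R : realType) (A : cstarAlgType R).

Record unitary : predArgType := Unitary {
  unitary_val : A;
  unitary_valP : is_unitary unitary_val
}.

HB.instance Definition _ := [isSub for unitary_val].
HB.instance Definition _ := [Choice of unitary by <:].

Definition unitary_one : unitary := Unitary (is_unitary1 A).
Definition unitary_mul (u v : unitary) : unitary :=
  Unitary (is_unitaryM (unitary_valP u) (unitary_valP v)).
Definition unitary_inv (u : unitary) : unitary :=
  Unitary (is_unitary_star (unitary_valP u)).

Lemma unitary_mulA : associative unitary_mul.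
Proof. by move=> u v w; apply: val_inj; rewrite /= mulrA. Qed.

Lemma unitary_mul1 : left_id unitary_one unitary_mul.
Proof. by move=> u; apply: val_inj; rewrite /= mul1r. Qed.

Lemma unitary_mulr1 : right_id unitary_one unitary_mul.
Proof. by move=> u; apply: val_inj; rewrite /= mulr1. Qed.

Lemma unitary_mulV : left_inverse unitary_one unitary_inv unitary_mul.
Proof. by case=> u /= uP; apply: val_inj => /=; case/andP: uP => /eqP. Qed.

Lemma unitary_mulrV : right_inverse unitary_one unitary_inv unitary_mul.
Proof. by case=> u /= uP; apply: val_inj => /=; case/andP: uP => _ /eqP. Qed.

HB.instance Definition _ := isGroup.Build unitary unitary_mulA unitary_mul1
  unitary_mulr1 unitary_mulV unitary_mulrV.

Definition expi (a : A) (sa : star a = a) : unitary := Unitary (cexp_unitary sa).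

End unitary.

Section maps.
Variables (R : realType) (A B : cstarAlgType R).

(* Norms on a normed module over R[i] are themselves valued in R[i], hence the
   embedding %:C of real bounds. *)
Record eps_star_hom (eps : R) (phi : A -> B) : Prop := EpsStarHom {
  eps_homB : forall a : A, `|a| <= 1 -> `|phi a| <= 1;
  eps_homD : forall a b : A, `|a| <= 1 -> `|b| <= 1 ->
    `|phi (a + b) - phi a - phi b| <= eps%:C;
  eps_homM : forall a b : A, `|a| <= 1 -> `|b| <= 1 ->
    `|phi (a * b) - phi a * phi b| <= eps%:C;
  eps_hom_star : forall a : A, `|a| <= 1 ->
    `|phi (star a) - star (phi a)| <= eps%:C;
  eps_homZ : forall (l : R[i]) (a : A), `|l| <= 1 -> `|a| <= 1 ->
    `|phi (l *: a) - l *: phi a| <= eps%:C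
}.

(* Not required to be unital. *)
Record star_hom (Phi : A -> B) : Prop := StarHom {
  star_homD : {morph Phi : a b / a + b};
  star_homZ : forall l : R[i], {morph Phi : a / l *: a};
  star_homM : {morph Phi : a b / a * b};
  star_hom_star : {morph Phi : a / star a}
}.

End maps.

(* Main.v *)
Require Import Defs.
From mathcomp Require Import all_boot all_order all_algebra.
From mathcomp Require Import all_classical all_reals all_analysis.
From mathcomp Require Import complex ring lra.

(** A group homomorphism [pi] that is merely close to the approximate
    homomorphism [phi] turns out to be rigid: it is differentiable, and its
    derivative yields an exact homomorphism.

    Continuity.  As [phi] is almost additive, [pi] maps unitaries close to 1 to
    unitaries not far from 1.  If [u], [u ^+ 2], ..., [u ^+ n] are all close to
    1 then so are their images, and the absence of small subgroups forces [pi u]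
    to be within [1 / n] of 1; hence [pi] is Lipschitz ([nearly_lipschitzW]).

    Derivative.  Therefore [a |-> pi (exp ('i a)) - 1] is additive up to a
    quadratic error, and Hyers' rescaling argument produces its derivative [D]
    at 0, which is real-linear ([additive_approximation], [generator_exists]).
    The complex-linear extension [Phi] of [- 'i D] is within a multiple of
    [sqrt eps] of [phi] on the unit ball ([extension_close]): expand at
    [exp ('i t a)] with [t] of order [sqrt eps].

    Multiplicativity.  Group commutators show that [D] preserves Lie brackets
    ([gen_lie]), so it remains to see that [Phi (a * a) = Phi a * Phi a] for
    self-adjoint [a].  The map [Phi] is linear and within 1/2 of [pi] on all
    unitaries, and the latter bound is uniform along the group generated by
    two commuting unitaries [u] and [v].  This group being amenable, one can
    average [g |-> pi g^-1 * Phi (g * c)] over it, and obtains a bounded linear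
    map that intertwines multiplication by [u], [v] with multiplication by
    [pi u], [pi v] and sends 1 to an invertible element.  Linear relations
    between commuting unitaries thus pass, with a fixed loss in norm, to their
    images ([commuting_relation]).  Applied to [exp ('i t a)] and
    [exp ('i t ^+ 2 (a * a))], this yields the claim at second order in [t]
    ([gen_jordan]).  Together the two parts make [Phi] multiplicative ([PhiM]).

    Exponentials.  [Phi] and [pi] agree to first order at [exp ('i b)], and
    taking the [2 ^ n]-th power at [b = 2 ^- n a] gives equality
    ([Phi_cexp]). *)

Set Implicit Arguments.
Unset Strict Implicit.
Unset Printing Implicit Defensive.

Import Order.TTheory GRing.Theory Num.Theory.
Import numFieldNormedType.Exports.

Local Open Scope classical_set_scope.
Local Open Scope ring_scope.
Local Open Scope complex_scope.

(** * Linear identities in a noncommutative algebra *)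

(** Signed sums of atoms, reified in order to decide equalities that hold in
    every abelian group: the identities needed below live in noncommutative
    algebras and become of this kind once products have been expanded. *)
Inductive zexpr :=
  ZAtom of nat | ZZero | ZOpp of zexpr | ZAdd of zexpr & zexpr.

Fixpoint zeval {V : zmodType} (env : seq V) (e : zexpr) : V :=
  match e with
  | ZAtom i => env`_i
  | ZZero => 0
  | ZOpp e1 => - zeval env e1
  | ZAdd e1 e2 => zeval env e1 + zeval env e2
  end.

Fixpoint zcoef (e : zexpr) (i : nat) : int :=
  match e with
  | ZAtom j => (i == j)%:Z
  | ZZero => 0
  | ZOpp e1 => - zcoef e1 i
  | ZAdd e1 e2 => zcoef e1 i + zcoef e2 i
  end.

Lemma zevalE {V : zmodType} (env : seq V) (e : zexpr) :
  zeval env e = \sum_(i < size env) env`_i *~ zcoef e i.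
Proof.
elim: e => [j||e IH|e1 IH1 e2 IH2] /=.
- have [jn|nj] := ltnP j (size env).
    rewrite (bigD1 (Ordinal jn))//= eqxx mulr1z big1 ?addr0// => i.
    by rewrite -val_eqE/= => /negbTE ->; rewrite mulr0z.
  rewrite nth_default// big1// => i _.
  by rewrite ltn_eqF ?mulr0z// (leq_trans (ltn_ord i)).
- by rewrite big1// => i _; rewrite mulr0z.
- by rewrite IH -sumrN; apply: eq_bigr => i _; rewrite mulrNz.
- by rewrite IH1 IH2 -big_split; apply: eq_bigr => i _; rewrite mulrzDr.
Qed.

Lemma zeval_eq {V : zmodType} (env : seq V) (e1 e2 : zexpr) :
  all (fun i => zcoef e1 i == zcoef e2 i) (iota 0 (size env)) ->
  zeval env e1 = zeval env e2.
Proof.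
move=> /allP eq12; rewrite !zevalE; apply: eq_bigr => i _.
by rewrite (eqP (eq12 i _))// mem_iota/=.
Qed.

(** Distinct inheritance paths produce units, products and applications that
    are convertible without being syntactically equal.  Atoms are compared
    structurally, and conversion is tried only on scalars and on the heads of
    applications, where it is cheap. *)
Ltac zsame x y :=
  match constr:((x, y)) with
  | (?z, ?z) => idtac
  | (GRing.one _, GRing.one _) => idtac
  | (?x1 * ?x2, ?y1 * ?y2) => zsame x1 y1; zsame x2 y2
  | (?k *: ?x1, ?l *: ?y1) => zsame x1 y1; unify k l
  | (?f ?x1, ?g ?y1) => zsame x1 y1; unify f g
  end.

Ltac zmem x env :=
  lazymatch env with
  | nil => constr:(false)
  | ?y :: ?env' =>
    match constr:(tt) with
    | _ => let _ := match constr:(tt) with _ => zsame x y end in constr:(true)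
    | _ => zmem x env'
    end
  end.

Ltac zatoms env t :=
  lazymatch t with
  | 0 => env
  | - ?x => zatoms env x
  | ?x + ?y => let env1 := zatoms env x in zatoms env1 y
  | ?x => lazymatch zmem x env with
          | true => env
          | false => constr:(x :: env)
          end
  end.

Ltac zindex x env :=
  lazymatch env with
  | ?y :: ?env' =>
    match constr:(tt) with
    | _ => let _ := match constr:(tt) with _ => zsame x y end in constr:(0%N)
    | _ => let n := zindex x env' in constr:(S n)
    end
  end.

Ltac zreify env t :=
  lazymatch t with
  | 0 => constr:(ZZero)
  | - ?x => let e := zreify env x in constr:(ZOpp e)
  | ?x + ?y => let e1 := zreify env x in
               let e2 := zreify env y in constr:(ZAdd e1 e2)
  | ?x => let n := zindex x env in constr:(ZAtom n)
  end.

(** The scaling rules, restated at type [cstarAlgType]: the generic ones leave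
    behind instances that later rewriting steps fail to match. *)
Section cstar_scale.
Variables (R : realType) (A : cstarAlgType R).
Implicit Types (x y : A) (k l : R[i]).

Lemma cscalerDr k x y : k *: (x + y) = k *: x + k *: y.
Proof. exact: scalerDr. Qed.

Lemma cscalerN k x : k *: (- x) = - (k *: x).
Proof. exact: scalerN. Qed.

Lemma cscaler0 k : k *: (0 : A) = 0.
Proof. exact: scaler0. Qed.

Lemma cscalerA k l x : k *: (l *: x) = (k * l) *: x.
Proof. exact: scalerA. Qed.

Lemma cscalerA_real (s t : R) x : s%:C *: (t%:C *: x) = (s * t)%:C *: x.
Proof. by rewrite scalerA -rmorphM. Qed.

Lemma cscalerDl_real (s t : R) x : (s + t)%:C *: x = s%:C *: x + t%:C *: x.
Proof. by rewrite -scalerDl -rmorphD. Qed.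

Lemma cscalerMl k x y : (k *: x) * y = k *: (x * y).
Proof. by rewrite cscalerAl. Qed.

Lemma cscalerMr k x y : x * (k *: y) = k *: (x * y).
Proof. by rewrite cscalerAr. Qed.

End cstar_scale.

(** Proves an equality of noncommutative polynomials with scalar coefficients,
    by expanding it and comparing the multiplicities of the scaled monomials;
    the coefficients themselves are not simplified. *)
Ltac zmod :=
  rewrite ?(mulrDl, mulrDr, mulNr, mulrN, mulr1, mul1r, mulr0, mul0r, mulrA,
            cscalerMl, cscalerMr, cscalerDr, cscalerN, cscaler0, cscalerA_real,
            cscalerA);
  lazymatch goal with
  | |- @eq ?T ?x ?y =>
    let env0 := zatoms (@nil T) x in
    let env := zatoms env0 y in
    let e1 := zreify env x in
    let e2 := zreify env y in
    refine (@zeval_eq _ env e1 e2 _); vm_compute; reflexivity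
  end.

(** * Real-valued norms and completeness *)

Section real_norm.
Variables (R : realType) (A : cstarAlgType R).
Implicit Types (x y z : A) (t e C : R).

Lemma rnorm0 : rnorm (0 : A) = 0.
Proof. by rewrite /rnorm normr0. Qed.

Lemma rnorm_eq0 x : rnorm x = 0 -> x = 0.
Proof. by move=> x0; apply/eqP; rewrite -normr_eq0 rnormE x0. Qed.

Lemma rnormZr t x : rnorm (t%:C *: x) = `|t| * rnorm x.
Proof. by rewrite rnormZ normc_def/= expr0n/= addr0 sqrtr_sqr. Qed.

Lemma rnormZi x : rnorm ('i%C *: x) = rnorm x.
Proof.
by rewrite rnormZ normc_def/= expr0n/= expr1n add0r sqrtr1 mul1r.
Qed.

Lemma rnorm_star x : rnorm (star x) = rnorm x.
Proof. by rewrite /rnorm norm_star. Qed.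

Lemma rnormB_le x y : rnorm (x - y) <= rnorm x + rnorm y.
Proof. by rewrite -(rnormN y) rnormD_le. Qed.

Lemma rnorm_dist y x z : rnorm (x - z) <= rnorm (x - y) + rnorm (y - z).
Proof. by rewrite (_ : x - z = x - y + (y - z)) ?rnormD_le//; zmod. Qed.

Lemma rnorm_distC x y : rnorm (x - y) = rnorm (y - x).
Proof. by rewrite -rnormN opprB. Qed.

Lemma rnorm_le_dist x y : rnorm x <= rnorm y + rnorm (x - y).
Proof. by have := rnormD_le y (x - y); rewrite addrC subrK. Qed.

Lemma rnorm_lin_eq0 C x :
  (forall t, 0 < t <= 1 -> rnorm x <= C * t) -> x = 0.
Proof.
move=> xC; apply: rnorm_eq0; apply/eqP; rewrite eq_le rnorm_ge0 andbT.
apply/ler_addgt0Pr => e e0; rewrite add0r.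
have C1 : 0 < `|C| + e by rewrite ltr_wpDl.
have /xC/le_trans : 0 < e / (`|C| + e) <= 1.
  by rewrite divr_gt0//= ler_pdivrMr// mul1r lerDr.
apply; rewrite mulrCA ger_pMr// ler_pdivrMr// mul1r.
by rewrite (le_trans (ler_norm _))// lerDl ltW.
Qed.

Lemma rnorm_harmonic_le0 C e t :
  (forall n, e <= t + C / n.+1%:R) -> e <= t.
Proof.
move=> et; apply/ler_addgt0Pr => d d0.
have [n] : exists n : nat, `|C| / d < n%:R.
  exists (Num.truncn (`|C| / d)).+1; rewrite truncnS_gt//.
move=> Cn; apply: (le_trans (et n)); rewrite lerD2l.
rewrite ler_pdivrMr ?ltr0n// (le_trans (ler_norm _))//.
rewrite mulrC -ler_pdivrMr// (le_trans (ltW Cn))// ler_nat//.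
Qed.

Lemma rnorm_cauchy_cvg (u : nat -> A) :
  (forall e, 0 < e -> exists N, forall m n, (N <= m)%N -> (N <= n)%N ->
     rnorm (u m - u n) < e) ->
  exists l : A, u @ \oo --> l.
Proof.
move=> cu; apply/cvg_ex/cauchy_cvgP/cauchy_exP => -[e e'].
rewrite ltcE/= => /andP[/eqP -> e0].
have [N uN] := cu _ e0; exists (u N), N => // n Nn.
by rewrite -ball_normE/= rnormE ltcR uN//=.
Qed.

Lemma rnorm_geometric_cvg (u : nat -> A) C :
  (forall n, rnorm (u n.+1 - u n) <= C / 2 ^+ n) ->
  exists l, forall n, rnorm (l - u n) <= 2 * C / 2 ^+ n.
Proof.
move=> uC.
have C0 : 0 <= C.
  by have := uC 0%N; rewrite expr0 divr1; apply: le_trans; exact: rnorm_ge0.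
have tail n k : rnorm (u (n + k)%N - u n) <= 2 * C / 2 ^+ n.
  (* The sharper bound is the exact sum of the first k increments. *)
  suff: rnorm (u (n + k)%N - u n) <= 2 * C / 2 ^+ n - 2 * C / 2 ^+ (n + k).
    move=> /le_trans -> //; rewrite lerBlDr lerDl.
    by rewrite divr_ge0 ?mulr_ge0 ?exprn_ge0.
  elim: k => [|k IH]; first by rewrite addn0 !subrr rnorm0.
  rewrite (le_trans (rnorm_dist (u (n + k)%N) _ _))//.
  rewrite addnS (le_trans (lerD (uC _) IH))// exprS.
  have : 0 < (2 : R) ^+ (n + k) by rewrite exprn_gt0.
  rewrite -subr_ge0; set w := 2 ^+ (n + k); set d := 2 * C / _; move=> w0.
  rewrite (_ : _ - _ = 0)//; rewrite /d; field; rewrite ?gt_eqF//.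
have [e e0|l ul] := @rnorm_cauchy_cvg u.
  have [N NC] : exists N : nat, 4 * C / e < N%:R.
    by exists (Num.truncn (4 * C / e)).+1; rewrite truncnS_gt.
  have lt2 : 2 * C / 2 ^+ N < e / 2.
    rewrite ltr_pdivrMr ?exprn_gt0//.
    rewrite (@lt_le_trans _ _ (e / 2 * N%:R))//.
      by move: NC; rewrite ltr_pdivrMr//; lra.
    have N2 : N%:R <= 2 ^+ N :> R by rewrite -natrX ler_nat ltnW// ltn_expl.
    by rewrite ler_wpM2l// divr_ge0// ltW.
  exists N => m n Nm Nn; rewrite (le_lt_trans (rnorm_dist (u N) _ _))//.
  rewrite (rnorm_distC (u N)) -(subnKC Nm) -(subnKC Nn).
  by rewrite (le_lt_trans (lerD (tail _ _) (tail _ _)))//; lra.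
exists l => n; move: ul => /rnorm_cvg/cvgrPdist_lt ul.
apply/ler_addgt0Pr => e /ul [N _ /(_ (n + N)%N)].
rewrite /= leq_addl sub0r normrN ger0_norm ?rnorm_ge0// => /(_ isT) lte.
rewrite (le_trans (rnorm_dist (u (n + N)%N) _ _))// addrC lerD ?tail//.
exact: ltW.
Qed.

End real_norm.

(** * The exponential series *)

Section exponential.
Variables (R : realType) (A : cstarAlgType R).
Implicit Types (x y a : A) (t : R).

(** Cauchy product: the square of a partial sum and the partial sum for
    [x + x] differ by terms which the corresponding real series dominate, and
    for those the difference tends to [expR r * expR r - expR (r + r) = 0]. *)
Lemma cexp_double x : cexp (x + x) = cexp x * cexp x.
Proof.
have conv n : \sum_(i < n.+1) ecoef x i * ecoef x (n - i)%N = ecoef (x + x) n.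
  rewrite /ecoef exprDn_comm// scaler_sumr; apply: eq_bigr => i _.
  rewrite -cscalerAl -cscalerAr scalerA -(@scaler_nat R[i] A 'C(n, i)) scalerA.
  rewrite -!exprD addnC; congr (_ *: _).
  have le_in : (i <= n)%N by rewrite -ltnS.
  rewrite -(bin_fact le_in) !natrM.
  have := fact_gt0 i; have := fact_gt0 (n - i)%N.
  have : (0 < 'C(n, i))%N by rewrite bin_gt0.
  rewrite -!(ltr0n R[i]) => c0 a0 b0.
  by field; rewrite !gt_eqF.
pose S y n := series (ecoef y) n.+1.
have cvS y : S y @ \oo --> cexp y.
  by have := @cexp_cvg _ _ y; rewrite -(cvg_shiftS (series (ecoef y))).
set r := rnorm x.
have cve (t : R) : series (exp_coeff t) n.+1 @[n --> \oo] --> expR t.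
  have := is_cvg_series_exp_coeff t.
  by rewrite -(cvg_shiftS (series (exp_coeff t))).
have bound n : rnorm (S x n * S x n - S (x + x) n) <=
    series (exp_coeff r) n.+1 * series (exp_coeff r) n.+1 -
    series (exp_coeff (r + r)) n.+1.
  rewrite /S /series/= !big_mkord !big_distrlr/=.
  rewrite (sum_square_triangle (fun i j => ecoef x i * ecoef x j)).
  rewrite (sum_square_triangle (fun i j => exp_coeff r i * exp_coeff r j)).
  under [X in X + _ - _]eq_bigr do rewrite conv.
  under [X in _ <= X + _ - _]eq_bigr do rewrite sum_exp_coeff.
  rewrite !(addrAC _ _ (- _)) !subrr !add0r.
  apply: (le_trans (rnorm_sum _ _ _)); apply: ler_sum => i _.
  apply: (le_trans (rnorm_sum _ _ _)); apply: ler_sum => j _.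
  by rewrite (le_trans (rnormM_le _ _))// ler_pM ?rnorm_ge0 ?rnorm_ecoef.
have /rnorm_cvg cv2 := cvS (x + x).
have /rnorm_cvg cvM := cvg_mul (cvS x) (cvS x).
have cvB : rnorm (S x n * S x n - S (x + x) n) @[n --> \oo] --> 0.
  apply: (@squeeze_cvgr _ _ _ _ (cst 0) (fun n =>
    series (exp_coeff r) n.+1 * series (exp_coeff r) n.+1 -
    series (exp_coeff (r + r)) n.+1)); last 2 first.
  - exact: cvg_cst.
  - rewrite (_ : 0 = expR r * expR r - expR (r + r)).
      by apply: cvgB => //; exact: cvgM.
    by rewrite expRD subrr.
  by near=> n; rewrite rnorm_ge0/= bound.
apply: (cvg_unique _ (cvS (x + x))); first exact: norm_hausdorff.
apply: cvg_rnorm.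
apply: (@squeeze_cvgr _ _ _ _ (cst 0) (fun n =>
    rnorm (cexp x * cexp x - S x n * S x n) +
    rnorm (S x n * S x n - S (x + x) n))); last 2 first.
- exact: cvg_cst.
- by rewrite -[X in _ --> X]addr0; exact: cvgD.
by near=> n; rewrite rnorm_ge0/= rnorm_dist.
Unshelve. all: by end_near. Qed.

Lemma cexp_dyadic x n : cexp x = cexp ((2^-1 ^+ n)%:C *: x) ^+ (2 ^ n).
Proof.
elim: n => [|n IH]; first by rewrite expr0 scale1r expr1.
have half : 2^-1 ^+ n = 2^-1 ^+ n.+1 + 2^-1 ^+ n.+1 :> R.
  by rewrite exprS; move: (2^-1 ^+ n) => w; lra.
by rewrite IH expnS exprM expr2 -cexp_double -scalerDl -rmorphD -half.
Qed.

Lemma cexp_quadratic x : rnorm x <= 1 / 2 ->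
  rnorm (cexp x - 1 - x) <= 2 * rnorm x ^+ 2.
Proof.
move=> x12; have x0 := rnorm_ge0 x.
have part n : rnorm (series (ecoef x) n.+2 - 1 - x) <=
    expR (rnorm x) - 1 - rnorm x.
  have -> : series (ecoef x) n.+2 - 1 - x = \sum_(k < n) ecoef x k.+2.
    rewrite /series/= big_mkord 2!big_ord_recl/= ecoef0 [ecoef x _]/ecoef.
    rewrite invr1 scale1r expr1.
    by rewrite -[\sum_(i < n) _]/(\sum_(k < n) ecoef x k.+2); zmod.
  apply: (@le_trans _ _ (series (exp_coeff (rnorm x)) n.+2 - 1 - rnorm x)).
    rewrite (_ : series _ _ - 1 - _ =
        \sum_(k < n) exp_coeff (rnorm x) k.+2); last first.
      rewrite /series/= big_mkord 2!big_ord_recl/= /exp_coeff/=.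
      rewrite fact0 expr0 expr1 divr1.
      rewrite divr1 (eq_bigr (fun k : 'I_n => exp_coeff (rnorm x) k.+2))//.
      by rewrite /exp_coeff/=; ring.
    apply: (le_trans (rnorm_sum _ _ _)); apply: ler_sum => k _.
    exact: rnorm_ecoef.
  rewrite !lerD2r.
  apply: nondecreasing_cvgn_le; last exact: is_cvg_series_exp_coeff.
  by apply: nondecreasing_series => k _ _; rewrite exp_coeff_ge0.
have expx : expR (rnorm x) - 1 - rnorm x <= 2 * rnorm x ^+ 2.
  (* From 1 - r <= exp (- r): exp r <= 1 / (1 - r) <= 1 + r + 2 r ^ 2. *)
  have := expR_ge1Dx (- rnorm x); rewrite expRN.
  have := expR_gt0 (rnorm x); move: (expR _) x0 x12.
  move: (rnorm x) => r e r0 r12 e0.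
  rewrite -(ler_pM2r e0) mulVf ?gt_eqF// => er.
  have : e <= 1 + r + 2 * r ^+ 2; last by lra.
  by nra.
have /rnorm_cvg/cvgrPdist_lt cx := @cexp_cvg _ _ x.
apply/ler_addgt0Pr => e /cx [N _ /(_ N.+2)]/=.
rewrite sub0r normrN ger0_norm ?rnorm_ge0// ltnW ?ltnS// => /(_ isT) lte.
have := le_trans (part N) expx.
have := rnorm_dist (series (ecoef x) N.+2) (cexp x) (1 + x).
by rewrite !opprD !addrA; lra.
Qed.

End exponential.

(** * Unitaries *)

Section unitary_norm.
Variables (R : realType) (A : cstarAlgType R).
Implicit Types (x a b : A) (u v : unitary A).

Lemma unitary_val_mulg u v :
  unitary_val (u * v)%g = unitary_val u * unitary_val v.
Proof. by []. Qed.

Lemma unitary_val_inv u : unitary_val u^-1%g = star (unitary_val u).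
Proof. by []. Qed.

Lemma unitary_val_expg u n : unitary_val (u ^+ n)%g = unitary_val u ^+ n.
Proof.
by elim: n => [|n IH]; rewrite ?expr0// expgS exprS unitary_val_mulg IH.
Qed.

Lemma unitary_starl u : star (unitary_val u) * unitary_val u = 1.
Proof. by have /andP[/eqP] := unitary_valP u. Qed.

Lemma unitary_starr u : unitary_val u * star (unitary_val u) = 1.
Proof. by have /andP[_ /eqP] := unitary_valP u. Qed.

Lemma unitary_mulKl u x : unitary_val u^-1%g * (unitary_val u * x) = x.
Proof. by rewrite mulrA unitary_starl mul1r. Qed.

Lemma rnorm_unitary_le u : rnorm (unitary_val u) <= 1.
Proof.
have := norm_starM (unitary_val u).
rewrite unitary_starl rnormE rnormE -rmorphXn => /complexI.
by have := rnorm1_le A; have := rnorm_ge0 (unitary_val u); nra.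
Qed.

Lemma rnorm_unitaryM_le u x : rnorm (unitary_val u * x) <= rnorm x.
Proof.
rewrite (le_trans (rnormM_le _ _))// ler_piMl ?rnorm_ge0//.
exact: rnorm_unitary_le.
Qed.

Lemma rnorm_Munitary_le u x : rnorm (x * unitary_val u) <= rnorm x.
Proof.
rewrite (le_trans (rnormM_le _ _))// ler_piMr ?rnorm_ge0//.
exact: rnorm_unitary_le.
Qed.

(** For small [a] this is the Taylor bound; for large [a] the left-hand side is
    at most [2 + rnorm a], because the exponential is unitary.  Having bounds
    without smallness hypotheses spares case distinctions later. *)
Lemma cexp_skew_quadratic a : star a = a ->
  rnorm (cexp ('i%C *: a) - 1 - 'i%C *: a) <= 10 * rnorm a ^+ 2.
Proof.
move=> sa; have a0 := rnorm_ge0 a.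
have [a12|a12] := lerP (rnorm a) (1 / 2).
  have := @cexp_quadratic _ _ ('i%C *: a); rewrite rnormZi => /(_ a12).
  by have := sqr_ge0 (rnorm a); lra.
have := rnormB_le (cexp ('i%C *: a) - 1) ('i%C *: a).
have := rnormB_le (cexp ('i%C *: a)) 1.
have := rnorm_unitary_le (expi sa); have := rnorm1_le A.
by rewrite /= rnormZi; nra.
Qed.

Lemma cexp_skew_linear a : star a = a ->
  rnorm (cexp ('i%C *: a) - 1) <= 4 * rnorm a.
Proof.
move=> sa; have a0 := rnorm_ge0 a.
have [a12|a12] := lerP (rnorm a) (1 / 2).
  have := @cexp_quadratic _ _ ('i%C *: a); rewrite rnormZi => /(_ a12).
  have := rnorm_le_dist (cexp ('i%C *: a) - 1) ('i%C *: a); rewrite rnormZi.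
  by nra.
have := rnormB_le (cexp ('i%C *: a)) 1.
by have := rnorm_unitary_le (expi sa); have := rnorm1_le A => /=; lra.
Qed.

End unitary_norm.

(** * Asymptotics at the origin *)

Section big_O.
Variables (R : realType) (A : cstarAlgType R).
Implicit Types (f g : R -> A) (x y : A) (k l : nat).

Definition isO k f :=
  exists2 C : R, 0 <= C & forall t, 0 < t <= 1 -> rnorm (f t) <= C * t ^+ k.

Lemma isOP k f (C : R) :
  (forall t, 0 < t <= 1 -> rnorm (f t) <= C * t ^+ k) -> isO k f.
Proof.
move=> fC; exists `|C| => // t t01; apply: (le_trans (fC _ t01)).
by rewrite ler_wpM2r ?ler_norm// exprn_ge0// ltW//; case/andP: t01.
Qed.

Lemma isO_ext k f g : (forall t, f t = g t) -> isO k f -> isO k g.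
Proof. by move=> fg [C C0 fC]; exists C => // t; rewrite -fg; exact: fC. Qed.

Lemma isOD k f g : isO k f -> isO k g -> isO k (fun t => f t + g t).
Proof.
move=> [C C0 fC] [D D0 gD]; exists (C + D) => [|t t01]; first exact: addr_ge0.
by rewrite (le_trans (rnormD_le _ _))// mulrDl lerD ?fC ?gD.
Qed.

Lemma isON k f : isO k f -> isO k (fun t => - f t).
Proof. by move=> [C C0 fC]; exists C => // t t01; rewrite rnormN fC. Qed.

Lemma isOB k f g : isO k f -> isO k g -> isO k (fun t => f t - g t).
Proof. by move=> fO gO; apply: isOD => //; exact: isON. Qed.

Lemma isOM k l f g : isO k f -> isO l g -> isO (k + l) (fun t => f t * g t).
Proof.
move=> [C C0 fC] [D D0 gD]; exists (C * D) => [|t t01]; first exact: mulr_ge0.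
rewrite (le_trans (rnormM_le _ _))// exprD mulrACA.
by rewrite ler_pM ?rnorm_ge0 ?fC ?gD.
Qed.

Lemma isO_weaken k l f : (k <= l)%N -> isO l f -> isO k f.
Proof.
move=> kl [C C0 fC]; exists C => // t t01; rewrite (le_trans (fC _ t01))//.
by rewrite ler_wpM2l// ler_wiXn2l//; case/andP: t01 => /ltW.
Qed.

Lemma isO_monomial k x : isO k (fun t => (t ^+ k)%:C *: x).
Proof.
apply: (@isOP _ _ (rnorm x)) => t /andP[t0 _].
by rewrite rnormZr ger0_norm ?exprn_ge0 ?(ltW t0)// mulrC.
Qed.

Lemma isO_unitary k f (u : R -> unitary A) :
  isO k f -> isO k (fun t => f t * unitary_val (u t)).
Proof.
move=> [C C0 fC]; exists C => // t t01.
by rewrite (le_trans (rnorm_Munitary_le _ _))// fC.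
Qed.

Lemma isO_scalei k f : isO k f -> isO k (fun t => 'i%C *: f t).
Proof. by move=> [C C0 fC]; exists C => // t t01; rewrite rnormZi fC. Qed.

(** First-order expansions determine products up to third order. *)
Lemma isO_product f g x y :
  isO 2 (fun t => f t - t%:C *: x) -> isO 2 (fun t => g t - t%:C *: y) ->
  isO 3 (fun t => f t * g t - (t ^+ 2)%:C *: (x * y)).
Proof.
move=> fx gy.
have g1 : isO 1 g.
  apply: isO_ext (isOD (isO_weaken (l := 2) _ gy) (isO_monomial 1 y)) => // t.
  by rewrite expr1 subrK.
apply: isO_ext (isOD (isOM fx g1) (isOM (isO_monomial 1 x) gy)) => t.
by rewrite expr1 expr2; zmod.
Qed.

(** How an asymptotic estimate becomes an exact identity. *)
Lemma isO_eq0 k x : isO k.+1 (fun t => (t ^+ k)%:C *: x) -> x = 0.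
Proof.
move=> [C C0 xC]; apply: (@rnorm_lin_eq0 _ _ C) => t t01.
have t0 : 0 < t by case/andP: t01.
have := xC _ t01; rewrite rnormZr ger0_norm ?exprn_ge0 ?(ltW t0)//.
by rewrite exprSr mulrA mulrAC mulrC ler_pM2r// exprn_gt0.
Qed.

End big_O.
Arguments isO {R A}.

(** * The Lipschitz property of the group homomorphism *)

Lemma rnormMn (R : realType) (A : cstarAlgType R) (x : A) n :
  rnorm (x *+ n) = n%:R * rnorm x.
Proof.
by rewrite -scaler_nat -(rmorph_nat (real_complex R)) rnormZr normr_nat.
Qed.

Lemma rnorm_expg_sub1 (R : realType) (A : cstarAlgType R) (u : unitary A) n :
  rnorm (unitary_val u ^+ n - 1) <= n%:R * rnorm (unitary_val u - 1).
Proof.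
elim: n => [|n IH]; first by rewrite expr0 subrr rnorm0 mul0r.
rewrite (_ : _ - 1 = unitary_val u * (unitary_val u ^+ n - 1) +
  (unitary_val u - 1)); last by rewrite exprS; zmod.
rewrite (le_trans (rnormD_le _ _))// -natr1 mulrDl mul1r lerD2r.
exact: le_trans (rnorm_unitaryM_le _ _) IH.
Qed.

Section group_morphism.
Variables (G H : groupType) (f : {multiplicative G -> H}).

Lemma multiplicative1 : f 1%g = 1%g.
Proof. by apply: (mulgI (f 1%g)); rewrite -gmulfM !mulg1. Qed.

Lemma multiplicativeV x : f x^-1%g = (f x)^-1%g.
Proof. by apply: (mulgI (f x)); rewrite -gmulfM !mulgV multiplicative1. Qed.

Lemma multiplicativeX x n : f (x ^+ n)%g = (f x ^+ n)%g.
Proof. by elim: n => [|n IH]; rewrite ?multiplicative1// !expgS gmulfM IH. Qed.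

End group_morphism.

Section lipschitz.
Variables (R : realType) (A B : cstarAlgType R).
Variable pi : {multiplicative unitary A -> unitary B}.
Implicit Types u v : unitary A.

Definition lipschitz8 := forall u v,
  rnorm (unitary_val (pi u) - unitary_val (pi v)) <=
    8 * rnorm (unitary_val u - unitary_val v).

Definition nearly_lipschitz := forall u v,
  rnorm (unitary_val u - unitary_val v) <= 1 / 4 ->
  rnorm (unitary_val (pi u) - unitary_val (pi v)) <= 1 / 2.

(** Let [p] be the image of [u].  As [u ^+ m] stays within 1/4 of 1 for
    [m <= n], the powers of [p] stay within 1/2 of 1, and so does their mean
    [M].  Since [p ^+ n - 1 = n (p - 1) M], the factor [p - 1] is [O(1 / n)]. *)
Lemma no_small_subgroup u n : nearly_lipschitz ->
  n%:R * rnorm (unitary_val u - 1) <= 1 / 4 ->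
  n%:R * rnorm (unitary_val (pi u) - 1) <= 1.
Proof.
move=> near un; set p := unitary_val (pi u).
have pow m : (m <= n)%N -> rnorm (p ^+ m - 1) <= 1 / 2.
  move=> mn; rewrite -unitary_val_expg -multiplicativeX.
  rewrite (_ : 1 = unitary_val (pi 1%g)); last by rewrite multiplicative1.
  apply: near; rewrite unitary_val_expg.
  apply: le_trans (rnorm_expg_sub1 _ _) (le_trans _ un).
  by rewrite ler_wpM2r ?rnorm_ge0// ler_nat.
have mean : (p - 1) *+ n = (p ^+ n - 1) - \sum_(i < n) (p - 1) * (p ^+ i - 1).
  under eq_bigr do rewrite mulrBr mulr1.
  by rewrite sumrB sumr_const card_ord -mulr_sumr -subrX1 subKr.
have : n%:R * rnorm (p - 1) <= 1 / 2 + n%:R * rnorm (p - 1) * (1 / 2).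
  rewrite -[X in X <= _]rnormMn mean (le_trans (rnormB_le _ _))// lerD ?pow//.
  rewrite (le_trans (rnorm_sum _ _ _))//.
  rewrite -mulrA mulr_natl -[n in leRHS]card_ord -sumr_const ler_sum// => i _.
  by rewrite (le_trans (rnormM_le _ _))// ler_wpM2l ?rnorm_ge0// pow// ltnW.
by lra.
Qed.

Lemma nearly_lipschitzW : nearly_lipschitz -> lipschitz8.
Proof.
move=> near u v.
have lip1 w : rnorm (unitary_val (pi w) - 1) <= 8 * rnorm (unitary_val w - 1).
  set e := rnorm (unitary_val (pi w) - 1); set d := rnorm (unitary_val w - 1).
  have d0 : 0 <= d := rnorm_ge0 _.
  rewrite leNgt; apply/negP => de.
  have e2 : e <= 2.
    have := rnormB_le (unitary_val (pi w)) 1; rewrite -/e.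
    by have := rnorm_unitary_le (pi w); have := rnorm1_le B; lra.
  have e0 : 0 < e by lra.
  have small n : n%:R * d <= 1 / 4 -> n%:R * e <= 1 by exact: no_small_subgroup.
  have e1 : e <= 1 by have := small 1%N; rewrite !mul1r; apply; lra.
  (* If e exceeded 8 d, the first n with n e > 1 would have n d <= 1 / 4. *)
  have [n1 n2] : (Num.truncn e^-1)%:R <= e^-1 /\ e^-1 < (Num.truncn e^-1).+1%:R.
    by apply/andP; rewrite truncn_itv// invr_ge0 ltW.
  move: n1 n2; set n := Num.truncn _ => n1 n2.
  have ne : n%:R * e <= 1 by rewrite -ler_pdivlMr// mul1r.
  have : 1 < n.+1%:R * e by rewrite -ltr_pdivrMr// mul1r.
  apply/negP; rewrite -leNgt small// -natr1.
  have : 0 <= n%:R :> R by [].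
  by move: n%:R ne => m ne m0; nra.
rewrite (_ : _ - _ = (unitary_val (pi (u * v^-1)%g) - 1) * unitary_val (pi v)).
  rewrite (le_trans (rnorm_Munitary_le _ _))// (le_trans (lip1 _))//.
  rewrite ler_wpM2l//.
  rewrite unitary_val_mulg unitary_val_inv.
  rewrite (_ : _ - 1 = (unitary_val u - unitary_val v) * unitary_val v^-1%g).
    exact: rnorm_Munitary_le.
  by rewrite mulrBl unitary_starr.
rewrite gmulfM multiplicativeV unitary_val_mulg unitary_val_inv mulrBl mul1r.
by rewrite -mulrA unitary_starl mulr1.
Qed.

End lipschitz.

(** * Additive approximation of almost additive maps *)

Section hyers.
Variables (R : realType) (A B : cstarAlgType R).
Variables (f : A -> B) (C K : R).
Hypothesis f_defect : forall a b,
  rnorm (f (a + b) - f a - f b) <= C * (rnorm a + rnorm b) ^+ 2.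
Hypothesis f_bounded : forall a, rnorm (f a) <= K * rnorm a.
Implicit Types (a b : A) (t : R).

Let half n a : A := (2^-1 ^+ n)%:C *: a.
Let dyad a n : B := (2 ^+ n)%:C *: f (half n a).

Let rnorm_half n a : rnorm (half n a) = rnorm a / 2 ^+ n.
Proof. by rewrite rnormZr ger0_norm ?exprn_ge0 ?invr_ge0// mulrC exprVn. Qed.

Let dyad_cvg a : exists l, forall n,
  rnorm (l - dyad a n) <= 2 * (C * rnorm a ^+ 2) / 2 ^+ n.
Proof.
apply: rnorm_geometric_cvg => n.
have eqn : half n a = half n.+1 a + half n.+1 a.
  rewrite /half -scalerDl -rmorphD/= exprS; congr (_%:C *: _).
  by move: (2^-1 ^+ n) => w; lra.
rewrite /dyad eqn; set c := half n.+1 a.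
rewrite (_ : _ - _ = (2 ^+ n)%:C *: - (f (c + c) - f c - f c)); last first.
  by rewrite exprS mulr_natl mulr2n cscalerDl_real; zmod.
rewrite rnormZr rnormN ger0_norm ?exprn_ge0//.
rewrite (le_trans (ler_wpM2l _ (f_defect _ _))) ?exprn_ge0//.
rewrite rnorm_half (exprS 2).
have := exprn_gt0 n (ltr0Sn R 1); move: (2 ^+ n) => w w0.
rewrite -subr_ge0 (_ : _ - _ = 0)//; field.
by rewrite gt_eqF.
Qed.

Let geometric_le_harmonic (b : R) n : b / 2 ^+ n <= `|b| / n.+1%:R.
Proof.
apply: (@le_trans _ _ (`|b| / 2 ^+ n)).
  by rewrite ler_wpM2r ?ler_norm// invr_ge0 exprn_ge0.
rewrite ler_wpM2l// lef_pV2 ?posrE ?exprn_gt0 ?ltr0n//.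
by rewrite -natrX ler_nat ltn_expl.
Qed.

Let vanish (x : B) (b : R) : (forall n, rnorm x <= b / 2 ^+ n) -> x = 0.
Proof.
move=> xb; apply/rnorm_eq0/eqP; rewrite eq_le rnorm_ge0 andbT.
apply: (@rnorm_harmonic_le0 _ `|b|) => n; rewrite add0r.
exact: le_trans (xb n) (geometric_le_harmonic _ _).
Qed.

(** Hyers' direct method near the origin.  A defect that is quadratic in the
    arguments makes the rescalings [2 ^+ n * f (2 ^- n * a)] converge
    geometrically, and it disappears in the limit; the limit is thus the
    derivative of [f] at 0. *)
Lemma additive_approximation : exists D : A -> B,
  [/\ {morph D : a b / a + b},
      forall t a, D (t%:C *: a) = t%:C *: D a,
      forall a, rnorm (D a) <= K * rnorm a &
      forall a, rnorm (D a - f a) <= 2 * C * rnorm a ^+ 2].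
Proof.
have [D Df] := choice dyad_cvg.
have DD a b : D (a + b) = D a + D b.
  suff : D (a + b) - D a - D b = 0.
    by rewrite -addrA -opprD => /eqP; rewrite subr_eq0 => /eqP.
  apply: (@vanish _ (2 * (C * rnorm (a + b) ^+ 2) + 2 * (C * rnorm a ^+ 2) +
    2 * (C * rnorm b ^+ 2) + C * (rnorm a + rnorm b) ^+ 2)) => n.
  rewrite (_ : _ - _ - _ = (D (a + b) - dyad (a + b) n) - (D a - dyad a n) -
    (D b - dyad b n) + (dyad (a + b) n - dyad a n - dyad b n)); last by zmod.
  rewrite (le_trans (rnormD_le _ _))// mulrDl lerD//; last first.
    rewrite /dyad -!scalerBr rnormZr ger0_norm ?exprn_ge0//.
    rewrite {1}/half scalerDr -/(half n a) -/(half n b).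
    rewrite (le_trans (ler_wpM2l _ (f_defect _ _))) ?exprn_ge0// !rnorm_half.
    have := exprn_gt0 n (ltr0Sn R 1); move: (2 ^+ n) => w w0.
    rewrite -subr_ge0 (_ : _ - _ = 0)//; field.
    by rewrite gt_eqF.
  rewrite (le_trans (rnormB_le _ _))// mulrDl lerD//.
  by rewrite (le_trans (rnormB_le _ _))// mulrDl lerD.
have Dle a : rnorm (D a) <= K * rnorm a.
  apply: (@rnorm_harmonic_le0 _ `|2 * (C * rnorm a ^+ 2)|) => n.
  rewrite (le_trans (rnorm_le_dist _ (dyad a n)))// lerD//.
    rewrite rnormZr ger0_norm ?exprn_ge0//.
    rewrite (le_trans (ler_wpM2l _ (f_bounded _))) ?exprn_ge0// rnorm_half.
    have := exprn_gt0 n (ltr0Sn R 1); move: (2 ^+ n) => w w0.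
    rewrite -subr_ge0 (_ : _ - _ = 0)//; field.
    by rewrite gt_eqF.
  exact: le_trans (Df a n) (geometric_le_harmonic _ _).
have D0 : D 0 = 0 by apply: (addrI (D 0)); rewrite -DD !addr0.
have DN a : D (- a) = - D a by apply: (addrI (D a)); rewrite -DD !subrr.
(* For fixed a, the defect of homogeneity E is additive in t, vanishes on
   integers and is bounded on [0, 1], hence is bounded, hence is zero. *)
pose E a t := D (t%:C *: a) - t%:C *: D a.
have ED a s t : E a (s + t) = E a s + E a t.
  by rewrite /E !cscalerDl_real DD; zmod.
have E0 a : E a 0 = 0 by rewrite /E !scale0r D0 subr0.
have E1 a : E a 1 = 0 by rewrite /E !scale1r subrr.
have EN a t : E a (- t) = - E a t.
  by apply: (addrI (E a t)); rewrite -ED !subrr E0.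
have EMn a t n : E a (t *+ n) = E a t *+ n.
  by elim: n => [|n IH]; rewrite ?mulr0n// !mulrS ED IH.
have Ebound a t : 0 <= t <= 1 -> rnorm (E a t) <= 2 * `|K| * rnorm a.
  move=> /andP[t0 t1]; rewrite (le_trans (rnormB_le _ _))//.
  have := Dle a; have := Dle (t%:C *: a); rewrite !rnormZr ger0_norm//.
  have := rnorm_ge0 a; have := rnorm_ge0 (D a); have := ler_norm K.
  have := normr_ge0 K.
  move: (rnorm (D (t%:C *: a))) (rnorm (D a)) (rnorm a) `|K|.
  move=> d1 d2 r k k0 Kk d20 r0 h1 h2.
  have : K * (t * r) <= k * r.
    rewrite (@le_trans _ _ (k * (t * r))) ?ler_wpM2r ?mulr_ge0//.
    by rewrite ler_wpM2l// ler_piMl.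
  have : t * d2 <= d2 by rewrite ler_piMl.
  have : K * r <= k * r by rewrite ler_wpM2r.
  by lra.
have Epos a t : 0 <= t -> E a t = 0.
  move=> t0; apply/rnorm_eq0/eqP; rewrite eq_le rnorm_ge0 andbT.
  apply: (@rnorm_harmonic_le0 _ (2 * `|K| * rnorm a)) => n; rewrite add0r.
  rewrite ler_pdivlMr ?ltr0n// mulrC -rnormMn -EMn.
  have /andP[] := truncn_itv (mulrn_wge0 n.+1 t0).
  set s := t *+ n.+1; set m := Num.truncn s => ms sm.
  rewrite (_ : s = 1 *+ m + (s - m%:R)); last by rewrite addrC subrK.
  rewrite ED EMn E1 mul0rn add0r Ebound// subr_ge0 ms lerBlDr addrC natr1.
  exact: ltW.
exists D; split=> // [t a|a]; last first.
  by have := Df a 0%N; rewrite /dyad /half !expr0 !scale1r divr1 mulrA.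
apply/eqP; rewrite -subr_eq0 -/(E a t); apply/eqP.
have [/Epos->//|t0] := leP 0 t.
by rewrite -(opprK t) EN Epos ?oppr0// oppr_ge0 ltW.
Qed.

End hyers.

(** * Exponentials of self-adjoint elements *)

Section hermitian_part.
Variables (R : realType) (A : cstarAlgType R).
Implicit Types (a b x y : A) (t : R).

Lemma starZr t a : star (t%:C *: a) = t%:C *: star a.
Proof.
rewrite starZ; congr (_ *: _).
by apply/eqP; rewrite eq_complex/= oppr0 !eqxx.
Qed.

Lemma starZi a : star ('i%C *: a) = - ('i%C *: star a).
Proof.
rewrite starZ -scaleNr; congr (_ *: _).
by apply/eqP; rewrite eq_complex/= oppr0 !eqxx.
Qed.

Lemma scaleii a : 'i%C *: ('i%C *: a) = - a.
Proof. by rewrite scalerA -expr2 sqr_i scaleN1r. Qed.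

Definition herm a : A := (2^-1)%:C *: (a + star a).

Lemma herm_sa a : star (herm a) = herm a.
Proof. by rewrite /herm starZr starD starK addrC. Qed.

Lemma hermD a b : herm (a + b) = herm a + herm b.
Proof. by rewrite /herm starD; zmod. Qed.

Lemma hermZr t a : herm (t%:C *: a) = t%:C *: herm a.
Proof. by rewrite /herm starZr -scalerDr !cscalerA_real mulrC. Qed.

Lemma halfD a : (2^-1)%:C *: a + (2^-1)%:C *: a = a.
Proof.
rewrite -cscalerDl_real (_ : 2^-1 + 2^-1 = 1 :> R) ?scale1r//.
by lra.
Qed.

Lemma herm_id a : star a = a -> herm a = a.
Proof. by move=> sa; rewrite /herm sa scalerDr halfD. Qed.

Lemma herm_star a : herm (star a) = herm a.
Proof. by rewrite /herm starK addrC. Qed.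

Lemma rnorm_herm_le a : rnorm (herm a) <= rnorm a.
Proof.
rewrite rnormZr ger0_norm ?invr_ge0//.
by have := rnormD_le a (star a); rewrite rnorm_star; lra.
Qed.

Lemma herm_decomposition a : a = herm a + 'i%C *: herm (- ('i%C *: a)).
Proof.
rewrite /herm starN starZi opprK scalerA (mulrC 'i%C) -scalerA.
rewrite (cscalerDr 'i%C) cscalerN !scaleii opprK -{1}(halfD a).
by zmod.
Qed.

(** Both exponentials have first-order part [1 + 'i x + 'i y], so only products
    of two small terms remain. *)
Lemma cexp_skew_defect x y : star x = x -> star y = y ->
  rnorm (cexp ('i%C *: (x + y)) - cexp ('i%C *: x) * cexp ('i%C *: y)) <=
    20 * (rnorm x + rnorm y) ^+ 2.
Proof.
move=> sx sy; have sxy : star (x + y) = x + y by rewrite starD sx sy.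
set ex := cexp ('i%C *: x); set ey := cexp ('i%C *: y).
set exy := cexp ('i%C *: (x + y)).
have -> : exy - ex * ey = (exy - 1 - 'i%C *: (x + y)) - (ex - 1 - 'i%C *: x) -
    (ey - 1 - 'i%C *: y) - (ex - 1) * (ey - 1) by zmod.
have := rnormM_le (ex - 1) (ey - 1).
have := cexp_skew_linear sx; have := cexp_skew_linear sy.
have := cexp_skew_quadratic sx; have := cexp_skew_quadratic sy.
have := cexp_skew_quadratic sxy; rewrite -/ex -/ey -/exy.
move: (exy - 1 - _) (ex - 1 - _) (ey - 1 - _) => a b c.
move: (ex - 1) (ey - 1) => d e.
move=> h1 h2 h3 h4 h5 h6.
have h7 := rnormB_le (a - b - c) (d * e).
have h8 := rnormB_le (a - b) c; have h9 := rnormB_le a b.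
have : rnorm (x + y) ^+ 2 <= (rnorm x + rnorm y) ^+ 2.
  by rewrite ler_sqr ?nnegrE ?addr_ge0 ?rnorm_ge0// rnormD_le.
have : rnorm d * rnorm e <= 4 * rnorm x * (4 * rnorm y).
  by rewrite ler_pM ?rnorm_ge0.
have := rnorm_ge0 x; have := rnorm_ge0 y.
by nra.
Qed.

(** Defined on all elements, through their self-adjoint parts, so that no proof
    of self-adjointness has to be carried along. *)
Definition expu a : unitary A := expi (herm_sa a).

Lemma unitary_val_expu a :
  star a = a -> unitary_val (expu a) = cexp ('i%C *: a).
Proof. by move=> sa; rewrite /= herm_id. Qed.

Lemma expi_expu a (sa : star a = a) : expi sa = expu a.
Proof. by apply: val_inj; rewrite /= herm_id. Qed.

Lemma expu_herm a : expu (herm a) = expu a.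
Proof. by apply: val_inj; rewrite /= (herm_id (herm_sa a)). Qed.

Lemma star_monomial k t a :
  star a = a -> star ((t ^+ k)%:C *: a) = (t ^+ k)%:C *: a.
Proof. by rewrite starZr => ->. Qed.

Lemma isO_expu k a : star a = a ->
  isO (k + k) (fun t => unitary_val (expu ((t ^+ k)%:C *: a)) - 1 -
    (t ^+ k)%:C *: ('i%C *: a)).
Proof.
move=> sa; apply: (@isOP _ _ _ _ (10 * rnorm a ^+ 2)) => t /andP[t0 t1].
rewrite unitary_val_expu ?star_monomial//.
have -> : (t ^+ k)%:C *: ('i%C *: a) = 'i%C *: ((t ^+ k)%:C *: a).
  by rewrite !scalerA mulrC.
apply: le_trans (cexp_skew_quadratic (star_monomial k t sa)) _.
rewrite rnormZr ger0_norm ?exprn_ge0 ?(ltW t0)// exprD.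
by rewrite le_eqVlt; apply/predU1P; left; ring.
Qed.

End hermitian_part.

Section commutator.
Variables (R : realType) (A : cstarAlgType R).

Lemma isO_unitary_inv (w : R -> unitary A) (x : A) :
  isO 2 (fun t => unitary_val (w t) - 1 - t%:C *: x) ->
  isO 1 (fun t => unitary_val (w t)^-1%g - 1).
Proof.
move=> wx; have : isO 1 (fun t => - (unitary_val (w t) - 1)).
  have := isOD (isO_weaken (l := 2) (isT : (1 <= 2)%N) wx) (isO_monomial 1 x).
  move=> /isON; apply: isO_ext => t.
  by rewrite expr1 subrK.
move=> /(@isO_unitary _ _ _ _ (fun t => (w t)^-1%g)); apply: isO_ext => t.
by rewrite mulNr mulrBl mul1r unitary_val_inv unitary_starr opprB.
Qed.

(** For a unitary [p] one has [p - 1 + (p^-1 - 1) = (p - 1) ^+ 2 * p^-1]: twice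
    the real part of [p - 1] is of second order, with leading term [x ^+ 2]. *)
Lemma isO_unitary_real_part (w : R -> unitary A) (x : A) :
  isO 2 (fun t => unitary_val (w t) - 1 - t%:C *: x) ->
  isO 3 (fun t => unitary_val (w t) - 1 + (unitary_val (w t)^-1%g - 1) -
    (t ^+ 2)%:C *: (x * x)).
Proof.
move=> wx; have := isOD (isO_unitary (fun t => (w t)^-1%g) (isO_product wx wx))
  (isOM (isO_monomial 2 (x * x)) (isO_unitary_inv wx)).
apply: isO_ext => t.
set p := unitary_val (w t); set q := unitary_val (w t)^-1%g.
have pq : p * q = 1 by exact: unitary_starr.
rewrite [(_ - _) * q]mulrBl -mulrA [(p - 1) * q]mulrBl pq mul1r.
rewrite [(p - 1) * _]mulrBr mulr1 [(p - 1) * q]mulrBl pq.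
by zmod.
Qed.

(** The group commutator of [p] and [q] differs from 1 by
    [((p - 1) * (q - 1) - (q - 1) * (p - 1)) * p^-1 * q^-1], so its leading
    term only involves the first-order parts of [p] and [q]. *)
Lemma isO_commutator (u v : R -> unitary A) (x y : A) :
  isO 2 (fun t => unitary_val (u t) - 1 - t%:C *: x) ->
  isO 2 (fun t => unitary_val (v t) - 1 - t%:C *: y) ->
  isO 3 (fun t => unitary_val (u t * v t * ((u t)^-1 * (v t)^-1))%g - 1 -
    (t ^+ 2)%:C *: (x * y - y * x)).
Proof.
move=> ux vy; set z := x * y - y * x.
have inv1 : isO 1 (fun t => unitary_val ((u t)^-1 * (v t)^-1)%g - 1).
  have := isOD (isO_unitary (fun t => (v t)^-1%g) (isO_unitary_inv ux))
    (isO_unitary_inv vy).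
  by apply: isO_ext => t; rewrite unitary_val_mulg; zmod.
have comm := isOB (isO_product ux vy) (isO_product vy ux).
have := isOD (isO_unitary (fun t => (u t)^-1 * (v t)^-1)%g comm)
  (isOM (isO_monomial 2 z) inv1).
apply: isO_ext => t; set w := unitary_val ((u t)^-1 * (v t)^-1)%g.
set p := unitary_val (u t); set q := unitary_val (v t).
have qpw : q * p * w = 1.
  rewrite /w unitary_val_mulg !unitary_val_inv mulrA -(mulrA q p).
  by rewrite unitary_starr mulr1 unitary_starr.
rewrite (_ : unitary_val _ = p * q * w)//.
rewrite (_ : (p - 1) * (q - 1) - _ - _ = p * q - q * p - (t ^+ 2)%:C *: z);
  last by zmod.
rewrite mulrBl [(p * q - _) * w]mulrBl qpw.
by zmod.
Qed.

Lemma comm_scaler (k : R[i]) (x y : A) :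
  GRing.comm x y -> GRing.comm (k *: x) y.
Proof. by rewrite /GRing.comm cscalerMl cscalerMr => ->. Qed.

Lemma cexp_comm (x y : A) : GRing.comm x y -> GRing.comm (cexp x) y.
Proof.
move=> xy; have cy : (fun _ : nat => y) @ \oo --> y by exact: cvg_cst.
apply: (cvg_unique _ (cvg_mul (@cexp_cvg _ _ x) cy)).
  exact: norm_hausdorff.
rewrite (_ : (fun n => _) = (fun n => y * series (ecoef x) n)).
  exact: (cvg_mul cy (@cexp_cvg _ _ x)).
apply/funext => n; rewrite /series/= mulr_suml mulr_sumr; apply: eq_bigr => i _.
rewrite /ecoef cscalerMl cscalerMr; congr (_ *: _).
exact/esym/commrX/commr_sym.
Qed.

End commutator.

(** * Averaging over commuting unitaries *)

Section mean.
Variables (R : realType) (B : cstarAlgType R).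
Implicit Types (F G : nat -> B) (x : B) (n : nat).

Definition mean n F : B := (n.+1%:R^-1)%:C *: \sum_(j < n.+1) F j.

Lemma meanD n F G : mean n (fun j => F j + G j) = mean n F + mean n G.
Proof. by rewrite /mean big_split scalerDr. Qed.

Lemma meanZ n k F : mean n (fun j => k *: F j) = k *: mean n F.
Proof. by rewrite /mean -scaler_sumr !scalerA mulrC. Qed.

Lemma meanB n F G : mean n (fun j => F j - G j) = mean n F - mean n G.
Proof. by rewrite /mean sumrB scalerBr. Qed.

Lemma meanMl n x F : mean n (fun j => x * F j) = x * mean n F.
Proof. by rewrite /mean -mulr_sumr cscalerMr. Qed.

Lemma mean_const n x : mean n (fun=> x) = x.
Proof.
rewrite /mean sumr_const card_ord -(@scaler_nat R[i] B) scalerA.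
rewrite -(rmorph_nat (real_complex R)) -rmorphM mulVf ?pnatr_eq0//.
by rewrite rmorph1 scale1r.
Qed.

Lemma eq_mean n F G : F =1 G -> mean n F = mean n G.
Proof. by move=> FG; rewrite /mean; under eq_bigr do rewrite FG. Qed.

Lemma rnorm_mean_le n F (b : R) :
  (forall j, rnorm (F j) <= b) -> rnorm (mean n F) <= b.
Proof.
move=> Fb; rewrite rnormZr ger0_norm ?invr_ge0// mulrC ler_pdivrMr ?ltr0n//.
rewrite (le_trans (rnorm_sum _ _ _))// mulr_natr -[n.+1 in leRHS]card_ord.
by rewrite -sumr_const ler_sum.
Qed.

Lemma mean_telescope n F : mean n (fun j => F j.+1 - F j) =
  (n.+1%:R^-1)%:C *: (F n.+1 - F 0%N).
Proof.
by rewrite /mean -(big_mkord xpredT (fun j => F j.+1 - F j)) telescope_sumr.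
Qed.

End mean.

Section averaging.
Variables (R : realType) (A B : cstarAlgType R).
Variable pi : {multiplicative unitary A -> unitary B}.
Implicit Types (u v g : unitary A) (c : A) (n : nat).

Record linear_near (K : R) (S : A -> B) : Prop := LinearNear {
  near_additive : {morph S : a b / a + b};
  near_homogeneous : forall k : R[i], {morph S : a / k *: a};
  near_bounded : forall a, rnorm (S a) <= K * rnorm a;
  near_unitary : forall g,
    rnorm (S (unitary_val g) - unitary_val (pi g)) <= 1 / 2
}.

Definition intertwines (e : R) u (S : A -> B) := forall c,
  rnorm (S (unitary_val u * c) - unitary_val (pi u) * S c) <= e * rnorm c.

(** Were the mean taken over the whole group generated by [u], it would be
    invariant and satisfy [S (u * c) = pi u * S c]; finitely many powers
    give this up to a boundary term. *)
Definition average u n (S : A -> B) (c : A) : B :=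
  mean n (fun j =>
    unitary_val (pi (u ^+ j)^-1%g) * S (unitary_val (u ^+ j)%g * c)).

Lemma average_near K u n S :
  0 <= K -> linear_near K S -> linear_near K (average u n S).
Proof.
move=> K0 [SD SZ Sle Su]; split=> [a b|k a|a|g].
- by rewrite -meanD; apply: eq_mean => j; rewrite mulrDr SD mulrDr.
- by rewrite -meanZ; apply: eq_mean => j; rewrite cscalerMr SZ cscalerMr.
- apply: rnorm_mean_le => j; rewrite (le_trans (rnorm_unitaryM_le _ _))//.
  by rewrite (le_trans (Sle _))// ler_wpM2l// rnorm_unitaryM_le.
- rewrite -[unitary_val (pi g)](mean_const n) -meanB.
  apply: rnorm_mean_le => j.
  rewrite -[unitary_val (pi g)](unitary_mulKl (pi (u ^+ j)%g)) -multiplicativeV.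
  rewrite -(unitary_val_mulg _ g) -(unitary_val_mulg _ (pi g)) -gmulfM -mulrBr.
  exact: le_trans (rnorm_unitaryM_le _ _) (Su _).
Qed.

Lemma average_intertwines K u n S : 0 <= K -> linear_near K S ->
  intertwines (2 * K / n.+1%:R) u (average u n S).
Proof.
move=> K0 [SD SZ Sle Su] c.
pose F j := unitary_val (pi (u ^+ j)^-1%g) * S (unitary_val (u ^+ j)%g * c).
have -> : average u n S (unitary_val u * c) =
    unitary_val (pi u) * mean n (fun j => F j.+1).
  rewrite -meanMl; apply: eq_mean => j; rewrite /F [RHS]mulrA.
  rewrite -(unitary_val_mulg (pi u)) -gmulfM expgSr invgM mulVKg.
  by rewrite unitary_val_mulg -mulrA.
rewrite -mulrBr (le_trans (rnorm_unitaryM_le _ _))// -meanB mean_telescope.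
rewrite rnormZr ger0_norm ?invr_ge0// mulrC mulrAC ler_wpM2r ?invr_ge0//.
have FK j : rnorm (F j) <= K * rnorm c.
  rewrite (le_trans (rnorm_unitaryM_le _ _))// (le_trans (Sle _))// ler_wpM2l//.
  exact: rnorm_unitaryM_le.
have := rnormB_le (F n.+1) (F 0%N); have := FK n.+1; have := FK 0%N.
by lra.
Qed.

Lemma average_keeps_intertwining u v n S e : 0 <= e -> commute u v ->
  intertwines e v S -> intertwines e v (average u n S).
Proof.
move=> e0 uv Sv c; rewrite -meanMl -meanB; apply: rnorm_mean_le => j.
have vuj : commute v (u ^+ j)%g by apply: commuteX; exact: commute_sym.
rewrite mulrA -unitary_val_mulg -vuj unitary_val_mulg -mulrA.
set d := unitary_val (u ^+ j)%g * c.
rewrite (_ : _ * (_ * S d) = unitary_val (pi (u ^+ j)^-1%g) *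
    (unitary_val (pi v) * S d)).
  rewrite -mulrBr (le_trans (rnorm_unitaryM_le _ _))// (le_trans (Sv _))//.
  by rewrite ler_wpM2l// rnorm_unitaryM_le.
rewrite 2!mulrA -!unitary_val_mulg -!gmulfM; congr (unitary_val (pi _) * _).
exact: commuteV.
Qed.

(** A linear map [T] with [T (g * c) = pi g * T c] for [g = u], [v] and with
    [T 1] close to 1 transports linear relations among [1], [u], [u^-1] and
    [v] to their images: it sends the combination [E] to [F * T 1], and
    [T 1] is invertible.  Averaging [S] over the powers of [v] and then over
    those of [u] yields such maps up to an error that tends to 0, at the cost
    of no increase of the norm; commutation keeps the second average from
    spoiling the first.  Thus [E] controls [F], although [pi] is only defined
    on unitaries. *)
Lemma commuting_relation K S u v : 0 <= K -> linear_near K S -> commute u v ->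
  rnorm (unitary_val (pi v) - 1 +
    'i%C *: (unitary_val (pi u) - 1 + (unitary_val (pi u^-1%g) - 1))) <=
  2 * K * rnorm (unitary_val v - 1 +
    'i%C *: (unitary_val u - 1 + (unitary_val u^-1%g - 1))).
Proof.
move=> K0 nearS uv; set F : B := _ + _; set E : A := _ + _.
apply: (@rnorm_harmonic_le0 _ (12 * K)) => n.
pose T := average u n (average v n S).
have nearT : linear_near K T by do 2!apply: average_near => //.
have e0 : 0 <= 2 * K / n.+1%:R by rewrite divr_ge0// mulr_ge0.
have Tu : intertwines (2 * K / n.+1%:R) u T.
  by apply: average_intertwines => //; exact: average_near.
have Tv : intertwines (2 * K / n.+1%:R) v T.
  by apply: average_keeps_intertwining => //; exact: average_intertwines.
clearbody T; case: nearT => TD TZ Tle Tnear.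
set e := 2 * K / n.+1%:R in e0 Tu Tv.
have TN a : T (- a) = - T a by rewrite -scaleN1r TZ scaleN1r.
have := Tu 1; have := Tv 1; have := Tu (unitary_val u^-1%g).
rewrite !mulr1 unitary_starr.
set X := T (unitary_val u^-1%g) => h1 h2 h3.
have h1' : rnorm (unitary_val (pi u^-1%g) * T 1 - X) <= e.
  rewrite -(unitary_mulKl (pi u) X) -multiplicativeV -mulrBr.
  rewrite (le_trans (rnorm_unitaryM_le _ _))// (le_trans h1)// ler_piMr//.
  exact: rnorm_unitary_le.
have le1 : e * rnorm (1 : A) <= e by rewrite ler_piMr// rnorm1_le.
have FT : rnorm (F * T 1) <= K * rnorm E + 3 * e.
  have -> : F * T 1 = T E - (T (unitary_val v) - unitary_val (pi v) * T 1) -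
      'i%C *: (T (unitary_val u) - unitary_val (pi u) * T 1) +
      'i%C *: (unitary_val (pi u^-1%g) * T 1 - X).
    by rewrite /E TD TZ !TD !TN /F /X; zmod.
  rewrite (le_trans (rnormD_le _ _))// rnormZi.
  have := rnormB_le (T E - (T (unitary_val v) - unitary_val (pi v) * T 1))
    ('i%C *: (T (unitary_val u) - unitary_val (pi u) * T 1)).
  have := rnormB_le (T E) (T (unitary_val v) - unitary_val (pi v) * T 1).
  have := Tle E; rewrite rnormZi; lra.
clearbody F E; have T1 : rnorm (T 1 - 1) <= 1 / 2.
  by have := Tnear 1%g; rewrite multiplicative1.
have : rnorm F <= rnorm (F * T 1) + rnorm F * (1 / 2).
  have := rnormB_le (F * T 1) (F * (T 1 - 1)).
  rewrite (_ : F * T 1 - F * (T 1 - 1) = F); last by zmod.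
  move=> /le_trans -> //; rewrite lerD2l (le_trans (rnormM_le _ _))//.
  by rewrite ler_wpM2l ?rnorm_ge0.
rewrite (_ : 12 * K / n.+1%:R = 6 * e); last by rewrite /e; ring.
by lra.
Qed.

End averaging.

(** * The generator of the group homomorphism *)

Section generator.
Variables (R : realType) (A B : cstarAlgType R).
Variable pi : {multiplicative unitary A -> unitary B}.
Implicit Types (a b : A) (t : R) (D : A -> B).

(** The derivative at 0 of [a |-> pi (exp ('i a))], so that [- 'i D] restricts
    to the map that [pi] induces on self-adjoint elements.  Only the
    self-adjoint part of [a] matters. *)
Record generator D : Prop := Generator {
  genD : {morph D : a b / a + b};
  genZ : forall t a, D (t%:C *: a) = t%:C *: D a;
  gen_bounded : forall a, rnorm (D a) <= 32 * rnorm a;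
  gen_quadratic : forall a,
    rnorm (D a - (unitary_val (pi (expu a)) - 1)) <= 1000 * rnorm a ^+ 2
}.

Lemma rnorm_pi_expu a : lipschitz8 pi ->
  rnorm (unitary_val (pi (expu a)) - 1) <= 32 * rnorm a.
Proof.
move=> lip; have := lip (expu a) 1%g.
rewrite multiplicative1 => /le_trans; apply.
have := cexp_skew_linear (herm_sa a); have := rnorm_herm_le a.
rewrite /=; lra.
Qed.

Lemma generator_exists : lipschitz8 pi -> exists D, generator D.
Proof.
move=> lip; pose f a : B := unitary_val (pi (expu a)) - 1.
have fK a : rnorm (f a) <= 32 * rnorm a by exact: rnorm_pi_expu.
have defect a b :
    rnorm (f (a + b) - f a - f b) <= 500 * (rnorm a + rnorm b) ^+ 2.
  have -> : f (a + b) - f a - f b =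
      (unitary_val (pi (expu (a + b))) -
       unitary_val (pi (expu a * expu b)%g)) + f a * f b.
    by rewrite /f gmulfM unitary_val_mulg; zmod.
  have := lip (expu (a + b)) (expu a * expu b)%g.
  have := cexp_skew_defect (herm_sa a) (herm_sa b); rewrite -hermD.
  rewrite unitary_val_mulg [unitary_val (expu _)]/= [unitary_val (expu a)]/=.
  rewrite [unitary_val (expu b)]/=.
  have := rnormD_le (unitary_val (pi (expu (a + b))) -
    unitary_val (pi (expu a * expu b)%g)) (f a * f b).
  have := rnormM_le (f a) (f b).
  have : rnorm (f a) * rnorm (f b) <= 32 * rnorm a * (32 * rnorm b).
    by rewrite ler_pM ?rnorm_ge0.
  have : (rnorm (herm a) + rnorm (herm b)) ^+ 2 <= (rnorm a + rnorm b) ^+ 2.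
    by rewrite ler_sqr ?nnegrE ?addr_ge0 ?rnorm_ge0// lerD ?rnorm_herm_le.
  have := sqr_ge0 (rnorm a - rnorm b).
  by nra.
have [D [DD DZ Dle Dq]] := additive_approximation defect fK.
by exists D; split=> // a; apply: le_trans (Dq a) _; rewrite -natrM.
Qed.

Section properties.
Variable D : A -> B.
Hypothesis gen : generator D.

Lemma gen0 : D 0 = 0.
Proof. by apply: (addrI (D 0)); rewrite -(genD gen) !addr0. Qed.

Lemma genN a : D (- a) = - D a.
Proof. by apply: (addrI (D a)); rewrite -(genD gen) !subrr gen0. Qed.

Lemma isO_gen k a : isO (k + k)
  (fun t =>
    unitary_val (pi (expu ((t ^+ k)%:C *: a))) - 1 - (t ^+ k)%:C *: D a).
Proof.
apply: (@isOP _ _ _ _ (1000 * rnorm a ^+ 2)) => t /andP[t0 t1].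
rewrite rnorm_distC -(genZ gen); apply: le_trans (gen_quadratic gen _) _.
rewrite rnormZr ger0_norm ?exprn_ge0 ?(ltW t0)// exprD.
by rewrite le_eqVlt; apply/predU1P; left; ring.
Qed.

Lemma gen_herm a : D (herm a) = D a.
Proof.
apply/eqP; rewrite -subr_eq0; apply/eqP/(@isO_eq0 _ _ 1).
apply: isO_ext (isOB (isO_gen 1 a) (isO_gen 1 (herm a))) => t.
by rewrite -hermZr expu_herm; zmod.
Qed.

Lemma gen_star a : star (D a) = - D a.
Proof.
rewrite -genN; apply/eqP; rewrite -subr_eq0; apply/eqP/(@isO_eq0 _ _ 1).
have [C C0 DC] := isO_gen 1 a.
have Ds : isO 2 (fun t => star (unitary_val (pi (expu ((t ^+ 1)%:C *: a))) - 1 -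
    (t ^+ 1)%:C *: D a)) by exists C => // t t01; rewrite rnorm_star DC.
apply: isO_ext (isOB (isO_gen 1 (- a)) Ds) => t.
set b := (t ^+ 1)%:C *: a.
have -> : expu ((t ^+ 1)%:C *: - a) = (expu b)^-1%g.
  apply: val_inj; rewrite /= star_cexp starZi herm_sa cscalerN -/b.
  by rewrite /herm starN -opprD cscalerN cscalerN.
rewrite multiplicativeV unitary_val_inv !starD !starN star1 starZr.
by zmod.
Qed.

(** Apply [pi] to the commutator of [exp ('i t a)] and [exp ('i t b)], which
    agrees with [exp ('i t ^+ 2 c)] to third order for [c = 'i (a b - b a)],
    and compare the terms of second order in the target. *)
Lemma gen_lie a b : lipschitz8 pi -> star a = a -> star b = b ->
  D ('i%C *: (a * b - b * a)) = D a * D b - D b * D a.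
Proof.
move=> lip sa sb; set c := 'i%C *: (a * b - b * a).
have sc : star c = c by rewrite starZi starD starN !starM sa sb -cscalerN opprB.
pose u (x : A) t := expu ((t ^+ 1)%:C *: x).
have Ou x : star x = x ->
    isO 2 (fun t => unitary_val (u x t) - 1 - t%:C *: ('i%C *: x)).
  by move=> sx; apply: isO_ext (isO_expu 1 sx) => t; rewrite /u expr1.
have Opi x : isO 2 (fun t => unitary_val (pi (u x t)) - 1 - t%:C *: D x).
  by apply: isO_ext (isO_gen 1 x) => t; rewrite /u expr1.
have near : isO 3 (fun t =>
    unitary_val (u a t * u b t * ((u a t)^-1 * (u b t)^-1))%g -
    unitary_val (expu ((t ^+ 2)%:C *: c))).
  apply: isO_ext (isOB (isO_commutator (Ou a sa) (Ou b sb))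
    (isO_weaken (l := 4) _ (isO_expu 2 sc))) => // t.
  rewrite /c !cscalerMl !cscalerMr !scaleii -!cscalerN.
  by zmod.
have piN : isO 3 (fun t =>
    unitary_val (pi (u a t) * pi (u b t) *
      ((pi (u a t))^-1 * (pi (u b t))^-1))%g -
    unitary_val (pi (expu ((t ^+ 2)%:C *: c)))).
  have [C C0 nearC] := near; apply: (@isOP _ _ _ _ (8 * C)) => t t01.
  rewrite -!multiplicativeV -!gmulfM (le_trans (lip _ _))// -mulrA ler_wpM2l//.
  exact: nearC.
apply/eqP; rewrite -subr_eq0; apply/eqP/(@isO_eq0 _ _ 2).
apply: isO_ext (isOB (isOB (isO_commutator (Opi a) (Opi b)) piN)
  (isO_weaken (l := 4) _ (isO_gen 2 c))) => // t.
by zmod.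
Qed.

(** The unitaries [u = exp ('i t a)] and [v = exp ('i t ^+ 2 a ^+ 2)] commute,
    and [v - 1 + 'i (u - 1 + (u^-1 - 1))] is of third order because the terms
    ['i t ^+ 2 a ^+ 2] cancel.  The relation between commuting unitaries and
    their images makes the same combination of images of third order, and its
    term of second order is [D (a * a) + 'i D a * D a]. *)
Lemma gen_jordan a K S : lipschitz8 pi -> star a = a -> 0 <= K ->
  linear_near pi K S -> D (a * a) = - ('i%C *: (D a * D a)).
Proof.
move=> lip sa K0 nearS; have saa : star (a * a) = a * a by rewrite starM sa.
pose u t := expu ((t ^+ 1)%:C *: a); pose v t := expu ((t ^+ 2)%:C *: (a * a)).
have uv t : commute (u t) (v t).
  apply: val_inj; rewrite /u /v/= !herm_id ?star_monomial//.
  apply: cexp_comm; do 2!apply: comm_scaler; apply: commr_sym.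
  apply: cexp_comm; do 2!apply: comm_scaler.
  exact/commr_sym/commrM.
have OA : isO 3 (fun t => unitary_val (v t) - 1 +
    'i%C *: (unitary_val (u t) - 1 + (unitary_val (u t)^-1%g - 1))).
  have Ou : isO 2 (fun t => unitary_val (u t) - 1 - t%:C *: ('i%C *: a)).
    by apply: isO_ext (isO_expu 1 sa) => t; rewrite /u expr1.
  apply: isO_ext (isOD (isO_weaken (l := 4) _ (isO_expu 2 saa))
    (isO_scalei (isO_unitary_real_part Ou))) => // t; rewrite -/(v t).
  rewrite cscalerMl cscalerMr scaleii (cscalerDr 'i%C) !cscalerN opprK.
  by rewrite (scalerA 'i%C) mulrC -(scalerA _ 'i%C) addrA addrAC subrK.
have OB : isO 3 (fun t => unitary_val (pi (v t)) - 1 +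
    'i%C *: (unitary_val (pi (u t)) - 1 + (unitary_val (pi (u t)^-1%g) - 1))).
  have [C C0 EC] := OA; apply: (@isOP _ _ _ _ (2 * K * C)) => t t01.
  rewrite (le_trans (commuting_relation K0 nearS (uv t)))// -[leRHS]mulrA.
  by rewrite ler_wpM2l ?mulr_ge0// EC.
have Opi : isO 2 (fun t => unitary_val (pi (u t)) - 1 - t%:C *: D a).
  by apply: isO_ext (isO_gen 1 a) => t; rewrite /u expr1.
apply/eqP; rewrite -subr_eq0 opprK; apply/eqP/(@isO_eq0 _ _ 2).
apply: isO_ext (isOB (isOB OB (isO_weaken (l := 4) _ (isO_gen 2 (a * a))))
  (isO_scalei (isO_unitary_real_part Opi))) => // t.
rewrite -/(v t) multiplicativeV [X in _ - X](cscalerDr 'i%C) cscalerN.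
rewrite (scalerA 'i%C) mulrC -(scalerA _ 'i%C).
by zmod.
Qed.

End properties.

End generator.

(** * From the generator to a homomorphism *)

Section star_extension.
Variables (R : realType) (A B : cstarAlgType R).
Variable pi : {multiplicative unitary A -> unitary B}.
Variable D : A -> B.
Hypothesis gen : generator pi D.
Implicit Types (a b c : A) (k : R[i]).

(** The complex-linear extension of [- 'i D] from the self-adjoint elements:
    [D] only sees self-adjoint parts, and the self-adjoint part of [- 'i a] is
    the imaginary part of [a]. *)
Definition extension a : B := D (- ('i%C *: a)) - 'i%C *: D a.
Local Notation Phi := extension.

Lemma extensionD a b : Phi (a + b) = Phi a + Phi b.
Proof. by rewrite /Phi cscalerDr opprD !(genD gen); zmod. Qed.

Lemma extensionZ k a : Phi (k *: a) = k *: Phi a.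
Proof.
have Zr t c : Phi (t%:C *: c) = t%:C *: Phi c.
  rewrite /Phi (genZ gen) scalerA mulrC -scalerA -scalerN (genZ gen) scalerBr.
  by rewrite !(scalerA _ _ (D c)) mulrC.
have Zi c : Phi ('i%C *: c) = 'i%C *: Phi c.
  rewrite /Phi scaleii opprK cscalerDr cscalerN scaleii opprK.
  by rewrite (genN gen) cscalerN addrC.
have kE x (V : cstarAlgType R) (y : V) :
    x *: y = (complex.Re x)%:C *: y + (complex.Im x)%:C *: ('i%C *: y).
  by rewrite scalerA -scalerDl mulrC -complexE.
by rewrite !(kE k) extensionD !Zr Zi.
Qed.

Lemma extension_star a : Phi (star a) = star (Phi a).
Proof.
have Dstar c : D (star c) = D c.
  by rewrite -(gen_herm gen) herm_star (gen_herm gen).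
rewrite /Phi -starZi !Dstar starD starN starZi !(gen_star gen) (genN gen).
by rewrite cscalerN !opprK.
Qed.

Lemma extension_bounded a : rnorm (Phi a) <= 64 * rnorm a.
Proof.
have := rnormB_le (D (- ('i%C *: a))) ('i%C *: D a); rewrite -/(Phi a).
have := gen_bounded gen a; have := gen_bounded gen (- ('i%C *: a)).
by rewrite rnormZi rnormN rnormZi; lra.
Qed.

Lemma extension_sa a : star a = a -> Phi a = - ('i%C *: D a).
Proof.
move=> sa; rewrite /Phi -(gen_herm gen (- _)) /herm starN starZi sa opprK addNr.
by rewrite scaler0 (gen0 gen) sub0r.
Qed.

End star_extension.

Section multiplicativity.
Variables (R : realType) (A B : cstarAlgType R).
Variable pi : {multiplicative unitary A -> unitary B}.
Hypothesis lip : lipschitz8 pi.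
Variable D : A -> B.
Hypothesis gen : generator pi D.
(* An abstract Phi, characterised by its values on self-adjoint elements:
   rewriting would otherwise unfold its definition. *)
Variable Phi : A -> B.
Hypothesis near : linear_near pi 64 Phi.
Hypothesis Phi_sa : forall a, star a = a -> Phi a = - ('i%C *: D a).
Implicit Types (a b c : A) (k : R[i]).

Lemma PhiN a : Phi (- a) = - Phi a.
Proof. by rewrite -scaleN1r (near_homogeneous near) scaleN1r. Qed.

Lemma Phi_sqr a : star a = a -> Phi (a * a) = Phi a * Phi a.
Proof.
move=> sa; have saa : star (a * a) = a * a by rewrite starM sa.
rewrite !Phi_sa// (gen_jordan gen lip sa _ near)//.
by rewrite cscalerN opprK mulNr mulrN opprK cscalerMl cscalerMr.
Qed.

(** Polarised squares give the symmetric part of a product, commutators the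
    antisymmetric part. *)
Lemma PhiM_sa a b :
  star a = a -> star b = b -> Phi (a * b) = Phi a * Phi b.
Proof.
move=> sa sb.
have anti : Phi (a * b) + Phi (b * a) = Phi a * Phi b + Phi b * Phi a.
  have := @Phi_sqr (a + b); rewrite starD sa sb => /(_ erefl).
  rewrite mulrDl !mulrDr !(near_additive near) !Phi_sqr// mulrDl !mulrDr => E.
  apply: (addrI (Phi a * Phi a)); apply: (addIr (Phi b * Phi b)).
  by move: E; rewrite !addrA.
have lie : Phi (a * b) - Phi (b * a) = Phi a * Phi b - Phi b * Phi a.
  rewrite -PhiN -(near_additive near).
  have sc : star ('i%C *: (a * b - b * a)) = 'i%C *: (a * b - b * a).
    by rewrite starZi starD starN !starM sa sb -cscalerN opprB.
  have := Phi_sa sc; rewrite (near_homogeneous near) (gen_lie gen)// => E.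
  apply: (@scalerI _ _ 'i%C); last rewrite E !Phi_sa//.
  - by rewrite eq_complex/= eqxx oner_eq0.
  by rewrite !mulrNN !cscalerMl !cscalerMr !scaleii; zmod.
rewrite -[LHS]halfD -[RHS]halfD -!cscalerDr.
congr (_ *: _).
have -> : Phi (a * b) + Phi (a * b) =
    (Phi (a * b) + Phi (b * a)) + (Phi (a * b) - Phi (b * a)) by zmod.
by rewrite anti lie; zmod.
Qed.

Lemma PhiM a b : Phi (a * b) = Phi a * Phi b.
Proof.
rewrite (herm_decomposition a) (herm_decomposition b).
move: (herm_sa a) (herm_sa (- ('i%C *: a))).
move: (herm_sa b) (herm_sa (- ('i%C *: b))).
move: (herm a) (herm (- ('i%C *: a))) (herm b) (herm (- ('i%C *: b))).
move=> x y z w sz sw sx sy.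
have PhiD := near_additive near; have PhiZ := near_homogeneous near.
rewrite (mulrDl x) !(mulrDr _ z) !(cscalerMl, cscalerMr) !PhiD !PhiZ.
by rewrite !PhiM_sa//; zmod.
Qed.

Lemma PhiX a n : Phi (a ^+ n.+1) = Phi a ^+ n.+1.
Proof. by elim: n => [|n IH]; rewrite ?expr1// exprS PhiM IH -exprS. Qed.

(** An idempotent of norm less than 1 is 0. *)
Lemma Phi1 : Phi 1 = 1.
Proof.
have : rnorm (1 - Phi 1) <= 1 / 2.
  by have := near_unitary near 1%g; rewrite multiplicative1 rnorm_distC.
set q := 1 - Phi 1 => q12.
have qq : q * q = q.
  by rewrite /q mulrBr mulr1 mulrBl mul1r -PhiM mulr1 subrr subr0.
have := rnormM_le q q; rewrite qq; have := rnorm_ge0 q => q0 qle.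
have /rnorm_eq0/eqP : rnorm q = 0 by nra.
by rewrite subr_eq0 eq_sym => /eqP.
Qed.

(** At [b = 2 ^- n a] the two sides differ by [O(4 ^- n)], because they have the
    same first-order part.  Both are multiplicative and bounded, so raising to
    the power [2 ^ n] multiplies the difference by at most [O(2 ^ n)]. *)
Lemma Phi_cexp a : star a = a ->
  Phi (cexp ('i%C *: a)) = unitary_val (pi (expu a)).
Proof.
move=> sa; apply/eqP; rewrite -subr_eq0; apply/eqP/rnorm_eq0/eqP.
rewrite eq_le rnorm_ge0 andbT.
have step b : star b = b ->
    rnorm (Phi (cexp ('i%C *: b)) - unitary_val (pi (expu b))) <=
      1640 * rnorm b ^+ 2.
  move=> sb; set e := cexp _.
  have -> : Phi e - unitary_val (pi (expu b)) =
      Phi (e - 1 - 'i%C *: b) + (D b - (unitary_val (pi (expu b)) - 1)).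
    rewrite !(near_additive near) !PhiN (near_homogeneous near) (Phi_sa sb).
    by rewrite cscalerN scaleii opprK Phi1; zmod.
  have := near_bounded near (e - 1 - 'i%C *: b).
  have := cexp_skew_quadratic sb; have := gen_quadratic gen b; rewrite -/e.
  have := rnormD_le (Phi (e - 1 - 'i%C *: b))
    (D b - (unitary_val (pi (expu b)) - 1)).
  by lra.
have power (w : unitary A) m : rnorm (Phi (unitary_val w ^+ m.+1) -
    unitary_val (pi w) ^+ m.+1) <=
    64 * m.+1%:R * rnorm (Phi (unitary_val w) - unitary_val (pi w)).
  set x := Phi (unitary_val w); set y := unitary_val (pi w).
  rewrite PhiX -/x; elim: m => [|m IH].
    by rewrite !expr1 mulr1; have := rnorm_ge0 (x - y); lra.
  rewrite (_ : _ - _ = x ^+ m.+1 * (x - y) + (x ^+ m.+1 - y ^+ m.+1) * y).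
    have := rnormD_le (x ^+ m.+1 * (x - y)) ((x ^+ m.+1 - y ^+ m.+1) * y).
    have := rnormM_le (x ^+ m.+1) (x - y).
    have := rnorm_Munitary_le (pi w) (x ^+ m.+1 - y ^+ m.+1); rewrite -/y.
    have : rnorm (x ^+ m.+1) * rnorm (x - y) <= 64 * rnorm (x - y).
      rewrite ler_wpM2r ?rnorm_ge0// -PhiX -unitary_val_expg.
      have := near_bounded near (unitary_val (w ^+ m.+1)%g).
      by have := rnorm_unitary_le (w ^+ m.+1)%g; lra.
    by rewrite -(natr1 m.+1); nra.
  by rewrite !(exprSr _ m.+1) mulrBr mulrBl; zmod.
apply: (@rnorm_harmonic_le0 _ (64 * 1640 * rnorm a ^+ 2)) => n; rewrite add0r.
pose b := (2^-1 ^+ n)%:C *: a.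
have sb : star b = b by rewrite starZr sa.
have expab : expu a = (expu b ^+ (2 ^ n))%g.
  apply: val_inj; rewrite -[LHS]/(unitary_val (expu a)) [RHS]unitary_val_expg.
  rewrite !unitary_val_expu//.
  rewrite (_ : 'i%C *: b = (2^-1 ^+ n)%:C *: ('i%C *: a)).
    exact: cexp_dyadic.
  by rewrite /b !scalerA mulrC.
have := power (expu b) (2 ^ n).-1; rewrite prednK ?expn_gt0//.
rewrite -(unitary_val_expg (expu b)) -(unitary_val_expg (pi (expu b))).
rewrite -multiplicativeX -expab (unitary_val_expu sa) (unitary_val_expu sb).
move=> /le_trans; apply.
have := step _ sb; rewrite rnormZr ger0_norm ?exprn_ge0 ?invr_ge0//.
move=> /(ler_wpM2l (_ : 0 <= 64 * (2 ^ n)%:R)) /le_trans; apply => //.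
have w0 : 0 < (2 : R) ^+ n by rewrite exprn_gt0.
rewrite exprVn natrX; set w : R := 2 ^+ n in w0 *.
rewrite (_ : 64 * w * _ = 64 * 1640 * rnorm a ^+ 2 / w); last first.
  by field; rewrite gt_eqF.
have c0 : 0 <= 64 * 1640 * rnorm a ^+ 2 by have := sqr_ge0 (rnorm a); lra.
rewrite (ler_wpM2l c0)// lef_pV2 ?posrE ?ltr0n//.
by rewrite /w -natrX ler_nat ltn_expl.
Qed.

End multiplicativity.

(** * Comparison with the approximate homomorphism *)

Section approximate_morphism.
Variables (R : realType) (A B : cstarAlgType R).
Variables (eps : R) (phi : A -> B).
Hypothesis eps_hom : eps_star_hom eps phi.
Implicit Types (a b : A) (t : R) (u v : unitary A).

Lemma norm_le1 (V : cstarAlgType R) (a : V) : rnorm a <= 1 -> `|a| <= 1.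
Proof. by rewrite le_rnorm rmorph1. Qed.

Lemma phiD a b : rnorm a <= 1 -> rnorm b <= 1 ->
  rnorm (phi (a + b) - phi a - phi b) <= eps.
Proof. by move=> a1 b1; rewrite le_rnorm (eps_homD eps_hom)// norm_le1. Qed.

Lemma phiZr t a : `|t| <= 1 -> rnorm a <= 1 ->
  rnorm (phi (t%:C *: a) - t%:C *: phi a) <= eps.
Proof.
move=> t1 a1; rewrite le_rnorm (eps_homZ eps_hom)// ?norm_le1//.
rewrite normc_def/= expr0n/= addr0 sqrtr_sqr.
by rewrite -(rmorph1 (real_complex R)) lecR.
Qed.

Lemma phiZi t a : `|t| <= 1 -> rnorm a <= 1 ->
  rnorm (phi ('i%C *: (t%:C *: a)) - 'i%C *: (t%:C *: phi a)) <= eps.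
Proof.
move=> t1 a1; rewrite le_rnorm !scalerA (eps_homZ eps_hom)// ?norm_le1//.
rewrite normrM ![`|_|]normc_def/= expr0n/= expr1n add0r sqrtr1 mul1r.
rewrite addr0 sqrtr_sqr.
by rewrite -(rmorph1 (real_complex R)) lecR.
Qed.

(** Approximate homogeneity, compared with the values on the unit sphere. *)
Lemma rnorm_phi_le a : rnorm a <= 1 -> rnorm (phi a) <= rnorm a + eps.
Proof.
move=> a1; have r0 := rnorm_ge0 a; have [z|nz] := eqVneq (rnorm a) 0.
  have := @phiZr 0 a; rewrite normr0 !scale0r subr0 => /(_ ler01 a1).
  by rewrite (rnorm_eq0 z) rnorm0 add0r.
have rpos : 0 < rnorm a by rewrite lt_neqAle eq_sym nz.
pose b := ((rnorm a)^-1)%:C *: a.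
have b1 : rnorm b = 1 by rewrite rnormZr ger0_norm ?invr_ge0// mulVf.
have ab : a = (rnorm a)%:C *: b by rewrite /b cscalerA_real mulfV// scale1r.
have := @phiZr (rnorm a) b; rewrite ger0_norm// b1 -ab => /(_ a1 (lexx _)) le1.
have := rnorm_le_dist (phi a) ((rnorm a)%:C *: phi b).
rewrite rnormZr ger0_norm//.
have : rnorm (phi b) <= 1.
  by rewrite le_rnorm rmorph1 (eps_homB eps_hom)// norm_le1 ?b1.
by nra.
Qed.

Variable pi : {multiplicative unitary A -> unitary B}.
Variable delta : R.
Hypothesis close : forall u,
  rnorm (phi (unitary_val u) - unitary_val (pi u)) <= delta.

Lemma nearly_lipschitz_of_close :
  2 * eps + 2 * delta <= 1 / 4 -> nearly_lipschitz pi.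
Proof.
move=> small u v uv.
set p := unitary_val u in uv *; set q := unitary_val v in uv *.
have d1 : rnorm (p - q) <= 1 by lra.
have := phiD (rnorm_unitary_le v) d1; rewrite -/q [q + _]addrC subrK => h1.
have h2 := rnorm_phi_le d1.
have h3 := close u; have h4 := close v; rewrite -/p -/q in h3 h4.
have h5 := rnorm_dist (phi p) (unitary_val (pi u)) (unitary_val (pi v)).
have h6 := rnorm_dist (phi q) (phi p) (unitary_val (pi v)).
have h7 := rnorm_le_dist (phi p - phi q) (phi (p - q)).
rewrite rnorm_distC in h3.
by lra.
Qed.

Variable D : A -> B.
Hypothesis gen : generator pi D.
Hypothesis delta2 : 2 * delta <= 3 * eps.

(** Expand [exp ('i t a) = 1 + 'i t a + O(t ^+ 2)] under both maps.  For [phi]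
    this costs a few [eps], which are of order [t ^+ 2] by the choice of [t];
    dividing by [t] leaves an error of order [t]. *)
Lemma generator_close t a : star a = a -> rnorm a <= 1 -> 0 < t <= 1 / 4 ->
  eps <= t ^+ 2 -> rnorm (D a - 'i%C *: phi a) <= 1017 * t.
Proof.
move=> sa a1 /andP[t0 t14] et.
have st : star (t%:C *: a) = t%:C *: a by rewrite starZr sa.
have tn : `|t| <= 1 by rewrite ger0_norm ?(ltW t0)//; lra.
have ta : rnorm (t%:C *: a) <= t.
  by rewrite rnormZr ger0_norm ?(ltW t0)// ler_piMr// (ltW t0).
have ta0 := rnorm_ge0 (t%:C *: a).
set x := 'i%C *: (t%:C *: a); set u := expu (t%:C *: a).
set e := unitary_val u; set r := e - 1 - x.
have eE : e = cexp x by rewrite /e unitary_val_expu.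
have r10 : rnorm r <= 10 * t ^+ 2.
  have := cexp_skew_quadratic st; rewrite -/x -eE -/r; nra.
have e1 : rnorm (e - 1) <= 1.
  by have := cexp_skew_linear st; rewrite -/x -eE; lra.
have x1 : rnorm x <= 1 by rewrite rnormZi; lra.
have r1 : rnorm r <= 1 by nra.
have h1 := phiD (rnorm1_le A) e1; rewrite [1 + _]addrC subrK in h1.
have h2 := phiD x1 r1.
rewrite (_ : x + r = e - 1) in h2; last by rewrite /r addrC subrK.
have h3 := phiZi tn a1; rewrite -/x in h3.
have h4 := rnorm_phi_le r1.
have h5 := close u; have := close 1%g.
rewrite multiplicative1 -/e rnorm_distC => h6.
have := gen_quadratic gen (t%:C *: a); rewrite (genZ gen) -/u => h7.
have h8 : rnorm (t%:C *: D a - (unitary_val (pi u) - 1)) <= 1000 * t ^+ 2.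
  by nra.
suff : rnorm (t%:C *: (D a - 'i%C *: phi a)) <=
    1010 * t ^+ 2 + 4 * eps + 2 * delta.
  rewrite rnormZr ger0_norm ?(ltW t0)// => le_t; rewrite -(ler_pM2l t0).
  apply: (le_trans le_t); have := delta2; have := et.
  by rewrite (_ : t * (1017 * t) = 1017 * t ^+ 2); [lra|ring].
have -> : t%:C *: (D a - 'i%C *: phi a) =
    (t%:C *: D a - (unitary_val (pi u) - 1)) - (phi e - unitary_val (pi u)) -
    (1 - phi 1) + (phi e - phi 1 - phi (e - 1)) +
    (phi (e - 1) - phi x - phi r) + (phi x - 'i%C *: (t%:C *: phi a)) + phi r.
  rewrite cscalerDr cscalerN.
  rewrite (_ : t%:C *: ('i%C *: phi a) = 'i%C *: (t%:C *: phi a)).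
    by zmod.
  by rewrite !scalerA mulrC.
move: (t%:C *: D a - _) (phi e - unitary_val (pi u)) h8 h5 => y1 y2 h8 h5.
move: (1 - phi 1) (phi e - phi 1 - _) h6 h1 => y3 y4 h6 h1.
move: (phi (e - 1) - _ - _) (phi x - _) h2 h3 => y5 y6 h2 h3.
have g1 := rnormB_le y1 y2; have g2 := rnormB_le (y1 - y2) y3.
have g3 := rnormD_le (y1 - y2 - y3) y4.
have g4 := rnormD_le (y1 - y2 - y3 + y4) y5.
have g5 := rnormD_le (y1 - y2 - y3 + y4 + y5) y6.
have g6 := rnormD_le (y1 - y2 - y3 + y4 + y5 + y6) (phi r).
by lra.
Qed.

Lemma extension_close t a : rnorm a <= 1 -> 0 < t <= 1 / 4 -> eps <= t ^+ 2 ->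
  rnorm (phi a - extension D a) <= 2040 * t.
Proof.
move=> a1 t01 et; have [t0 t14] := andP t01.
set x := herm a; set y := herm (- ('i%C *: a)).
have x1 : rnorm x <= 1 by rewrite (le_trans (rnorm_herm_le _)).
have y1 : rnorm y <= 1.
  by rewrite (le_trans (rnorm_herm_le _))// rnormN rnormZi.
have iy1 : rnorm ('i%C *: y) <= 1 by rewrite rnormZi.
have axy : a = x + 'i%C *: y by exact: herm_decomposition.
have h1 := phiD x1 iy1; rewrite -axy in h1.
have h2 := @phiZi 1 y; rewrite !scale1r normr1 in h2.
have {}h2 := h2 (lexx _) y1.
have hx := generator_close (herm_sa a) x1 t01 et.
have hy := generator_close (herm_sa _) y1 t01 et.
have -> : phi a - extension D a = (phi a - phi x - phi ('i%C *: y)) +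
    (phi ('i%C *: y) - 'i%C *: phi y) + 'i%C *: (D x - 'i%C *: phi x) -
    (D y - 'i%C *: phi y).
  rewrite /extension -(gen_herm gen a) -(gen_herm gen (- _)) -/x -/y.
  by rewrite (cscalerDr 'i%C (D x)) cscalerN scaleii; zmod.
have g1 := rnormD_le (phi a - phi x - phi ('i%C *: y))
  (phi ('i%C *: y) - 'i%C *: phi y).
set z1 := _ + _ in g1; have g2 := rnormD_le z1 ('i%C *: (D x - 'i%C *: phi x)).
set z2 := _ + _ in g2; have g3 := rnormB_le z2 (D y - 'i%C *: phi y).
rewrite rnormZi in g2; rewrite -/x -/y in hx hy.
by nra.
Qed.

End approximate_morphism.

(** * The theorem *)


Theorem theorem3p1 (R : realType) :
  exists (h : R -> R) (eps0 : R),
    [/\ 0 < eps0, h e @[e --> 0^'+] --> 0 &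
    forall (eps : R) (A B : cstarAlgType R) (phi : A -> B)
        (pi : {multiplicative unitary A -> unitary B}),
      0 <= eps < eps0 ->
      eps_star_hom eps phi ->
      (forall u : unitary A,
        `|phi (unitary_val u) - unitary_val (pi u)| <= (eps + 120 * eps ^+ 2)%:C) ->
      exists Phi : A -> B,
        [/\ star_hom Phi,
            forall (a : A) (sa : star a = a),
              Phi (cexp ('i%C *: a)) = unitary_val (pi (expi sa)) &
            forall a : A, `|a| <= 1 -> `|phi a - Phi a| <= (h eps)%:C]].
Proof.
(* The bound on eps gives 2040 * sqrt eps + eps + 120 * eps ^+ 2 <= 1 / 2. *)
exists (fun e => 2040 * Num.sqrt e), ((1 / 50 / 100) ^+ 2); split.
- by rewrite exprn_gt0 ?divr_gt0.
- apply: cvg_at_right_filter.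
  rewrite -[X in _ --> X](mulr0 2040) -[X in 2040 * X]sqrtr0.
  by apply: cvgM; [exact: cvg_cst|exact: sqrt_continuous].
move=> eps A B phi pi /andP[eps_ge0 eps_small] eps_hom close0.
set s := Num.sqrt eps; have s0 : 0 <= s := sqrtr_ge0 _.
have ss : s ^+ 2 = eps := sqr_sqrtr eps_ge0.
have s_small : s < 1 / 50 / 100.
  by rewrite -(@ltr_pXn2r _ 2) ?nnegrE ?ss ?divr_ge0.
have eps_lt : eps <= 1 / 1000 by move: eps_small; rewrite expr2; lra.
set delta := eps + 120 * eps ^+ 2 in close0.
have close u : rnorm (phi (unitary_val u) - unitary_val (pi u)) <= delta.
  by rewrite le_rnorm.
have delta2 : 2 * delta <= 3 * eps by rewrite /delta; nra.
have lip : lipschitz8 pi.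
  apply/nearly_lipschitzW/(nearly_lipschitz_of_close eps_hom close).
  by lra.
have [D gen] := generator_exists lip.
have Phi_close a : rnorm a <= 1 -> rnorm (phi a - extension D a) <= 2040 * s.
  move=> a1; apply/ler_addgt0Pr => e e0.
  (* The comparison needs t > 0 and eps <= t ^+ 2: take t = s + d, d -> 0. *)
  have [d [d0 d1 de]] : exists d : R, [/\ 0 < d, d <= 1 / 8 & 2040 * d <= e].
    have c0 : 0 < 2040 :> R by rewrite ltr0n.
    exists (Num.min (e / 2040) (1 / 8)); rewrite lt_min ge_min lexx orbT.
    rewrite (divr_gt0 e0 c0) [2040 * _]mulrC -(ler_pdivlMr _ _ c0) ge_min lexx.
    by split=> //=; rewrite divr_gt0.
  have t0 : 0 < s + d <= 1 / 4 by apply/andP; split; lra.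
  have le_t : eps <= (s + d) ^+ 2 by rewrite -ss; nra.
  have := extension_close eps_hom close gen delta2 a1 t0 le_t.
  by lra.
have near : linear_near pi 64 (extension D).
  split; [exact: (extensionD gen)|exact: (extensionZ gen)| |].
    exact: (extension_bounded gen).
  move=> u; have := Phi_close _ (rnorm_unitary_le u); have := close u.
  have := rnorm_dist (phi (unitary_val u)) (extension D (unitary_val u))
    (unitary_val (pi u)).
  by rewrite (rnorm_distC _ (phi _)); lra.
have Phi_sa := extension_sa gen.
exists (extension D); split.
- split; [exact: (extensionD gen)|exact: (extensionZ gen)| |].
    exact: (PhiM lip gen near Phi_sa).
  exact: (extension_star gen).
- by move=> a sa; rewrite expi_expu; exact: (Phi_cexp lip gen near Phi_sa sa).
- move=> a; rewrite -(rmorph1 (real_complex R)) -!le_rnorm; exact: Phi_close.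
Qed.
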